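(* Let $N_1,N_2>1$ be integers such that every prime factor of $N_2$ is a prime factor of $N_1$. Then $(\Sigma_{N_1}^{\mathbb{Z}},\Pi_{\alpha,N_1})$ has $(\Sigma_{N_2}^{\mathbb{Z}},\Pi_{\alpha,N_2})$ as a factor via $\mathrm{Fact}_{N_1,N_2}$ for any $\alpha>0$ such that the maps $\Pi_{\alpha,N_1}$ and $\Pi_{\alpha,N_2}$ are defined. Additionally, if $x\in\Sigma_{N_1}^{\mathbb{Z}}$ is such that $\mathrm{real}_{N_1}(x)$ is finite, then $\mathrm{real}_{N_2}(\mathrm{Fact}_{N_1,N_2}(x))=\mathrm{real}_{N_1}(x)$.
   Context: **Dynamics.** A dynamical system $(X,T)$ is a compact metrizable space $X$ with a continuous $T:X\to X$. $(X,T)$ has $(Y,S)$ as a factor via $\psi$ if $\psi:X\to Y$ is a continuous surjection with $\psi\circ T=S\circ\psi$. $\mathbb{N}=\{0,1,2,\dots\}$, $\Sigma_N=\{0,\dots,N-1\}$; $\Sigma_N^{\mathbb{Z}}$ has the prodiscrete topology. $\mathrm{real}_N(x)=\sum_{i=-\infty}^{\infty}x[-i]N^i\in[0,\infty]$ for $x\in\Sigma_N^{\mathbb{Z}}$. **Multiplication automata.** For $p$ dividing $N$ with $N=pq$, $\Pi_{p,N}:\Sigma_N^{\mathbb{Z}}\to\Sigma_N^{\mathbb{Z}}$ is $\Pi_{p,N}(x)[i]=g_{p,N}(x[i],x[i+1])$, where $g_{p,N}(a_1q+a_0,b_1q+b_0)=a_0p+b_1$ for $a_0,b_0\in\Sigma_q$,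 $a_1,b_1\in\Sigma_p$. These maps are bijective and commute. If $\alpha=p/q$ with $p=\prod p_i$, $q=\prod q_j$ products of positive divisors $p_i,q_j$ of $N$, then $\Pi_{\alpha,N}$ is the composition of the maps $\Pi_{p_i,N}$ and $\Pi_{q_j,N}^{-1}$ (independent of the decomposition). $\Pi_{\alpha,N}$ is ''defined'' exactly for such $\alpha$. **Multiplication cubes.** Vectors are ordered coordinatewise; $\mathbf{k}=(k,\dots,k)$; $e_i$ are the standard basis vectors. A prebasis of dimension $d$ is $n\in\mathbb{Z}_+^d$; put $N=\prod_i n[i]$ and $m(n,v)=\prod_{j=1}^d n[j]^{-v[j]}$ for $v\in\mathbb{Z}^d$. For $a\in\mathbb{N}$ and $\mathbf{0}\ge v_1\ge v_2$ in $\mathbb{Z}^d$, $\mathrm{base}_n(a,(v_1,v_2))[2]$ denotes the integer $a_1$ in the unique representation $a=a_0+a_1m(n,v_1)+a_2m(n,v_2)$ with $0\le a_0<m(n,v_1)$, $0\le a_1<m(n,v_2)/m(n,v_1)$, $a_2\ge0$. For $a\in\Sigma_N$, $\mathrm{cube}_n(a)$ is the function on pairs $v_1\ge v_2$ in $\{-1,0\}^d$ given by $\mathrm{cube}_n(a)[v_1,v_2]=\mathrm{base}_n(a,(v_1,v_2))[2]$. $T_n=\{\mathrm{cube}_n(a):a\in\Sigma_N\}$, $\mathrm{val}_n(t)=t[\mathbf{0},-\mathbf{1}]$ (so $\mathrm{val}_n(\mathrm{cube}_n(a))=a$). $X_n$ is the set of $f:\mathbb{Z}^d\to T_n$ such that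 $f[z][\mathbf{0},-\mathbf{1}+e_i]=f[z+e_i][-e_i,-\mathbf{1}]$ for all $z\in\mathbb{Z}^d$, $1\le i\le d$. **Labels.** For $f\in X_n$, the edge $\{z-e_i,z\}$ has label $\lambda(f,\{z-e_i,z\})=f[z][\mathbf{0},-e_i]$. If $p'-p=ae_j$ with $a=\pm1$, $(p,p')f=a\,m(n,\max\{p,p'\})\lambda(f,\{p,p'\})$. For general $p,p'\in\mathbb{Z}^d$, $(p,p')f=\sum_i(P_i,P_{i+1})f$ over any path of unit steps from $p$ to $p'$ (independent of the path), and $\lambda(f,(p,p'))=(p,p')f/m(n,p')$. **Macrotile and microtile maps.** For a $d\times d'$ matrix $A$ over $\mathbb{N}$, $n^A\in\mathbb{Z}_+^{d'}$ is $n^A[i]=m(n,-Ae_i)$, and $\mathrm{M}_{A,n}:X_n\to X_{n^A}$ is $\mathrm{M}_{A,n}(f)[v]=\mathrm{cube}_{n^A}(\lambda(f,(A(v-\mathbf{1}),Av)))$ for $v\in\mathbb{Z}^{d'}$. If every row of $A$ contains a positive integer, $\mu_{A,n}:X_{n^A}\to X_n$ is defined as follows: for $f\in X_{n^A}$, $x\in\mathbb{Z}^d$ choose $z_1\in\mathbb{Z}^{d'}$ with $v:=Az_1-x\ge\mathbf{0}$ and $z_2\le z_1$ with $Az_2\le x-\mathbf{1}$, let $a=\lambda(f,(z_2,z_1))\in\mathbb{N}$, and put $\mu_{A,n}(f)[x]=\mathrm{cube}_n(\mathrm{base}_n(a,(-v,-v-\mathbf{1}))[2])$ (independent of choices; the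 result is in $X_n$). **Tessellations and configurations.** $\mathrm{tess}_n:\Sigma_N^{\mathbb{Z}}\to X_n$ is $\mathrm{tess}_n(x)[z]=\mathrm{cube}_n(\Pi_{\alpha(z,n),N}(x)[0])$ with $\alpha(z,n)=\prod_i n[i]^{z[i]}$; $\mathrm{diag}_n:X_n\to\Sigma_N^{\mathbb{Z}}$ is $\mathrm{diag}_n(f)[i]=\mathrm{val}_n(f[\mathbf{i}])$. **The maps $\mathrm{Conj}$ and $\mathrm{Fact}$.** For $N>1$ with prime decomposition $N=\prod_{i=1}^d p_i^{k_i}$ ($p_1<\dots<p_d$, $k_i\ge1$), let $n=(p_1^{k_1},\dots,p_d^{k_d})$, $m=(p_1,\dots,p_d)$, $M=\prod_i p_i$, and let $A_N$ be the diagonal matrix with diagonal $(k_1,\dots,k_d)$, so $n=m^{A_N}$. Then $\mathrm{Conj}_{N,M}=\mathrm{diag}_m\circ\mu_{A_N,m}\circ\mathrm{tess}_n$ (a bijection $\Sigma_N^{\mathbb{Z}}\to\Sigma_M^{\mathbb{Z}}$). If $N'>1$ is divisible by the same primes as $N$, then $\mathrm{Conj}_{N,N'}=\mathrm{Conj}_{N',M}^{-1}\circ\mathrm{Conj}_{N,M}$. Next, if $M=\prod_{i=1}^d p_i>1$ with $p_1<\dots<p_d$ primes, $m=(p_1,\dots,p_d)$, and $M'>1$ divides $M$, write $M'=\prod_{i=1}^{d'}p_{k_i}$ with $(k_i)$ a subsequence of $(1,\dots,d)$, let $m'=(p_{k_1},\dots,p_{k_{d'}})$ and let $A_{M,M'}$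 be the $d\times d'$ matrix with $i$th column $e_{k_i}\in\mathbb{Z}^d$, so $m'=m^{A_{M,M'}}$; put $\mathrm{Fact}_{M,M'}=\mathrm{diag}_{m'}\circ\mathrm{M}_{A_{M,M'},m}\circ\mathrm{tess}_m$. If $N,N'>1$ are divisible by the same primes as $M,M'$ respectively, $\mathrm{Fact}_{N,N'}=\mathrm{Conj}_{M',N'}\circ\mathrm{Fact}_{M,M'}\circ\mathrm{Conj}_{N,M}$. *)

(* Defs.v *)
From HB Require Import structures.
From mathcomp Require Import all_boot all_order all_algebra.
From mathcomp Require Import all_classical all_reals all_analysis.

Set Implicit Arguments.
Unset Strict Implicit.
Unset Printing Implicit Defensive.

Import Order.TTheory GRing.Theory Num.Theory.

Local Open Scope classical_set_scope.
Local Open Scope ring_scope.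

(** * Dynamical systems *)

Definition metrizable (R : realType) (X : topologicalType) : Prop :=
  exists dist : X -> X -> R,
    [/\ forall x y, dist x y = 0 <-> x = y,
        forall x y, dist x y = dist y x,
        forall x y z, dist x z <= dist x y + dist y z
      & forall x (A : set X),
          nbhs x A <-> exists2 e : R, 0 < e & [set y | dist x y < e] `<=` A].

Definition dynamical_system (R : realType) (X : topologicalType) (T : X -> X)
    : Prop :=
  [/\ compact [set: X], metrizable R X & continuous T].

Definition has_factor_via (R : realType) (X Y : topologicalType)
    (T : X -> X) (S : Y -> Y) (psi : X -> Y) : Prop :=
  [/\ dynamical_system R T, dynamical_system R S, continuous psi,
      (forall y, exists x, psi x = y)
    & forall x, psi (T x) = S (psi x)].

(** * Configurations *)

(* For N > 0 this is {0, ..., N - 1}; the form [N.-1.+1] makes it inhabited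
   for every N. *)
Definition Sigma (N : nat) : Type := 'I_N.-1.+1.

Definition conf (N : nat) := {ptws int -> discrete_topology (Sigma N)}.

Definition digit N (x : conf N) (i : int) : nat := (x i : 'I_N.-1.+1).

Definition mkconf N (x : int -> nat) : conf N :=
  fun i => inord (x i) : 'I_N.-1.+1.

Definition real_val (R : realType) N (x : conf N) : \bar R :=
  \esum_(i in [set: int]) ((digit x (- i))%:R * N%:R ^ i)%:E.
Arguments real_val R {N} x.

(** * Multiplication automata *)

(* With q = N / p, a = a1 q + a0 and b = b1 q + b0. *)
Definition g_mul (p N a b : nat) : nat :=
  let q := (N %/ p)%N in (a %% q * p + b %/ q)%N.

Definition Pi_div N (p : nat) (x : conf N) : conf N :=
  mkconf N (fun i => g_mul p N (digit x i) (digit x (i + 1))).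
Arguments Pi_div N p x : clear implicits.

Definition pos_divisor (N p : nat) : bool := (0 < p)%N && (p %| N)%N.

Definition Pi_decomp N (alpha : rat) (pq : seq nat * seq nat) : Prop :=
  [/\ all (pos_divisor N) pq.1, all (pos_divisor N) pq.2
    & alpha = (\prod_(p <- pq.1) p)%N%:R / (\prod_(q <- pq.2) q)%N%:R].

Definition Pi_defined N (alpha : rat) : Prop :=
  exists pq, Pi_decomp N alpha pq.

(* The inverse of F when F is bijective; the default value is then unused. *)
Definition inv_map N N' (F : conf N -> conf N') : conf N' -> conf N :=
  'pinv_(fun=> (fun=> ord0) : conf N) [set: conf N] F.

Definition Pi_comp N (pq : seq nat * seq nat) : conf N -> conf N :=
  foldr (fun p F => Pi_div N p \o F) id pq.1 \o
  foldr (fun q F => inv_map (Pi_div N q) \o F) id pq.2.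

(* Pi_{alpha,N} does not depend on the decomposition of alpha: one is chosen. *)
Definition Pi N (alpha : rat) : conf N -> conf N :=
  Pi_comp (xget ([::], [::]) (Pi_decomp N alpha)).
Arguments Pi N alpha x : clear implicits.

(** * Multiplication cubes *)

Notation vec d := 'cV[int]_d.

Definition e_ {d} (i : 'I_d) : vec d := delta_mx i ord0.

Definition allc {d} (k : int) : vec d := const_mx k.

Definition vle {d} (u v : vec d) : bool := [forall i, u i ord0 <= v i ord0].

Definition matvec {d d'} (A : 'M[nat]_(d, d')) (v : vec d') : vec d :=
  map_mx Posz A *m v.

(* A prebasis of dimension d is given by its entries n : 'I_d -> nat. *)
Definition m_ {d} (n : 'I_d -> nat) (v : vec d) : rat :=
  \prod_(j < d) (n j)%:R ^ (- v j ord0).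

Definition base_repr {d} (n : 'I_d -> nat) (a : nat) (v1 v2 : vec d)
    (a0 a1 a2 : nat) : Prop :=
  [/\ a%:R = a0%:R + a1%:R * m_ n v1 + a2%:R * m_ n v2,
      a0%:R < m_ n v1 & a1%:R < m_ n v2 / m_ n v1].

Definition base2 {d} (n : 'I_d -> nat) (a : nat) (v1 v2 : vec d) : nat :=
  xget 0%N [set a1 | exists a0 a2, base_repr n a v1 v2 a0 a1 a2].

Definition cube_dom {d} (v1 v2 : vec d) : bool :=
  [&& vle (allc (- 1)) v2, vle v2 v1 & vle v1 (allc 0)].

(* A cube is a function on the pairs in [cube_dom], extended by 0 elsewhere. *)
Definition cubefun d := vec d -> vec d -> nat.

Definition cube {d} (n : 'I_d -> nat) (a : nat) : cubefun d :=
  fun v1 v2 => if cube_dom v1 v2 then base2 n a v1 v2 else 0%N.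

Definition val_ {d} (t : cubefun d) : nat := t (allc 0) (allc (- 1)).

Definition T_ {d} (n : 'I_d -> nat) : set (cubefun d) :=
  [set t | exists2 a, (a < \prod_(i < d) n i)%N & t = cube n a].

Definition tiling d := vec d -> cubefun d.

Definition X_ {d} (n : 'I_d -> nat) : set (tiling d) :=
  [set f | (forall z, T_ n (f z)) /\
           (forall z (i : 'I_d), f z (allc 0) (allc (- 1) + e_ i) =
                                 f (z + e_ i) (- e_ i) (allc (- 1)))].

(* The operations below take arbitrary tilings; they are only meant for
   elements of [X_ n], where they do not depend on the choices made. *)

(** * Labels *)

(* The label of the edge {z - e_i, z}. *)
Definition edge_label {d} (f : tiling d) (z : vec d) (i : 'I_d) : nat :=
  f z (allc 0) (- e_ i).

Definition unit_step {d} : rel (vec d) :=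
  fun p p' => [exists j : 'I_d, (p' - p == e_ j) || (p - p' == e_ j)].

(* (p, p')f when p' - p = e_j or p' - p = - e_j; at most one term is nonzero. *)
Definition step_val {d} (n : 'I_d -> nat) (f : tiling d) (p p' : vec d) : rat :=
  \sum_(j < d)
    (if p' - p == e_ j then m_ n p' * (edge_label f p' j)%:R
     else if p - p' == e_ j then - (m_ n p * (edge_label f p j)%:R)
     else 0).

Fixpoint path_val {d} (n : 'I_d -> nat) (f : tiling d) (p : vec d)
    (s : seq (vec d)) : rat :=
  if s is p' :: s' then step_val n f p p' + path_val n f p' s' else 0.

Definition pair_val {d} (n : 'I_d -> nat) (f : tiling d) (p p' : vec d) : rat :=
  path_val n f p
    (xget [::] [set s : seq (vec d) | path unit_step p s /\ last p s = p']).

Definition label {d} (n : 'I_d -> nat) (f : tiling d) (p p' : vec d) : rat :=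
  pair_val n f p p' / m_ n p'.

(** * Macrotile and microtile maps *)

(* The i-th entry is m(n, - A e_i). *)
Definition prebasis_exp {d d'} (n : 'I_d -> nat) (A : 'M[nat]_(d, d'))
    : 'I_d' -> nat :=
  fun i => (\prod_(j < d) n j ^ A j i)%N.

(* [Num.truncn] only converts labels that are natural numbers to type nat. *)
Definition macro {d d'} (A : 'M[nat]_(d, d')) (n : 'I_d -> nat)
    (f : tiling d) : tiling d' :=
  fun v => cube (prebasis_exp n A)
    (Num.truncn (label n f (matvec A (v - allc 1)) (matvec A v))).

Definition micro_choice {d d'} (A : 'M[nat]_(d, d')) (x : vec d)
    (z : vec d' * vec d') : Prop :=
  [/\ vle 0 (matvec A z.1 - x), vle z.2 z.1 & vle (matvec A z.2) (x - allc 1)].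

Definition micro {d d'} (A : 'M[nat]_(d, d')) (n : 'I_d -> nat)
    (f : tiling d') : tiling d :=
  fun x =>
    let z := xget (0, 0) (micro_choice A x) in
    let v := matvec A z.1 - x in
    let a := Num.truncn (label (prebasis_exp n A) f z.2 z.1) in
    cube n (base2 n a (- v) (- v - allc 1)).

(** * Tessellations and configurations *)

(* In [tess N n] and [diag N n], N stands for the product of the entries
   of n. *)
Definition alpha_ {d} (z : vec d) (n : 'I_d -> nat) : rat :=
  \prod_(i < d) (n i)%:R ^ z i ord0.

Definition tess N {d} (n : 'I_d -> nat) (x : conf N) : tiling d :=
  fun z => cube n (digit (Pi N (alpha_ z n) x) 0).
Arguments tess N {d} n x.

Definition diag N {d} (n : 'I_d -> nat) (f : tiling d) : conf N :=
  mkconf N (fun i => val_ (f (allc i))).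

(** * The maps Conj and Fact *)

Definition rad (N : nat) : nat := (\prod_(p <- primes N) p)%N.

Definition nprimes (N : nat) : nat := size (primes N).

Definition prime_basis (N : nat) : 'I_(nprimes N) -> nat :=
  fun i => nth 0%N (primes N) i.
Arguments prime_basis N i : clear implicits.

Definition prime_power_basis (N : nat) : 'I_(nprimes N) -> nat :=
  fun i => (prime_basis N i ^ logn (prime_basis N i) N)%N.
Arguments prime_power_basis N i : clear implicits.

Definition A_Conj (N : nat) : 'M[nat]_(nprimes N) :=
  diag_mx (\row_i logn (prime_basis N i) N).

(* Conj_{N,M} with M = rad N; M is an argument in order to avoid transports
   between [conf M] and [conf (rad N)]. *)
Definition Conj_rad (N M : nat) : conf N -> conf M :=
  fun x => diag M (prime_basis N)
    (micro (A_Conj N) (prime_basis N) (tess N (prime_power_basis N) x)).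
Arguments Conj_rad N M x : clear implicits.

(* N and N' have the same prime divisors. *)
Definition Conj (N N' : nat) : conf N -> conf N' :=
  inv_map (Conj_rad N' (rad N)) \o Conj_rad N (rad N).
Arguments Conj N N' x : clear implicits.

(* The column of index j is e_(k_j), where k_j is the index of the j-th prime
   divisor of M' among those of M. *)
Definition A_Fact (M M' : nat) : 'M[nat]_(nprimes M, nprimes M') :=
  \matrix_(i, j) (prime_basis M i == prime_basis M' j : nat).

(* M is squarefree and M' divides M. *)
Definition Fact_sqfree (M M' : nat) : conf M -> conf M' :=
  fun x => diag M' (prime_basis M')
    (macro (A_Fact M M') (prime_basis M) (tess M (prime_basis M) x)).
Arguments Fact_sqfree M M' x : clear implicits.

Definition Fact (N N' : nat) : conf N -> conf N' :=
  Conj (rad N') N' \o Fact_sqfree (rad N) (rad N') \o Conj_rad N (rad N).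
Arguments Fact N N' x : clear implicits.

(* Main.v *)
Require Import Defs.
From mathcomp Require Import all_boot all_order all_algebra.
From mathcomp Require Import all_classical all_reals all_analysis.
From mathcomp Require Import zify ring.
Import Order.TTheory GRing.Theory Num.Theory.
Local Open Scope ring_scope.

(* A configuration x over Sigma_N represents a possibly infinite number X, and
   for N-smooth r and s the residue floor (X r) mod s is well defined: it is
   read off finitely many digits. These residues determine x, and Pi_alpha acts
   on them by the shift r |-> alpha r. The values of tess are residues at
   r = alpha(z, n), and labels are residues at the end point of the path, so the
   microtile and macrotile maps preserve residues. Hence Conj and Fact preserve
   residues: they rewrite the same X in another base, which gives equivariance
   and, X being determined by the integer parts of X r, the invariance of real.
   Surjectivity holds by compactness, because the image contains arbitrarily
   good approximations of any y, obtained from rational X. *)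

Set Implicit Arguments.
Unset Strict Implicit.
Unset Printing Implicit Defensive.

(** * Smooth numbers *)

Lemma pnat_gt0 (pi : nat_pred) s : pi.-nat s -> (0 < s)%N.
Proof. by case/andP. Qed.

(** The exponent [s] is enough: every prime of [s] divides [N], and its multiplicity in [s] is below
    [s]. *)
Lemma pnat_dvd_exp N s : (0 < N)%N -> \pi(N).-nat s ->
  exists k, (s %| N ^ k)%N.
Proof.
move=> N0 sN; have s0 := pnat_gt0 sN; exists s.
apply/(dvdn_partP _ s0) => p ps; rewrite p_part.
have pN : (p %| N)%N.
  move: ps; rewrite mem_primes => /and3P[pp _ pds].
  by have /(pnatP _ s0)/(_ p pp pds) := sN; rewrite mem_primes => /and3P[].
apply: dvdn_trans (dvdn_exp2l p _) (dvdn_exp2r _ pN).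
by rewrite ltnW // ltn_logl.
Qed.

Lemma pnat_dvd_pi N d : (0 < N)%N -> (d %| N)%N -> \pi(N).-nat d.
Proof. by move=> N0 dN; apply: pnat_dvd dN _; rewrite pnat_pi. Qed.

Lemma pnat_trans N N' s : \pi(N).-nat N' -> \pi(N').-nat s -> \pi(N).-nat s.
Proof.
move=> N'N; apply: sub_in_pnat => p _; rewrite mem_primes => /and3P[pp N'0 pN'].
by have /(pnatP _ N'0)/(_ p pp pN') := N'N.
Qed.

Definition smooth_ratio (N : nat) (r : rat) : Prop :=
  exists a b, [/\ \pi(N).-nat a, \pi(N).-nat b & r = a%:R / b%:R].

Lemma smooth_ratio_gt0 N r : smooth_ratio N r -> 0 < r.
Proof.
by move=> [a [b [/pnat_gt0 a0 /pnat_gt0 b0 ->]]]; rewrite divr_gt0 ?ltr0n.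
Qed.

Lemma smooth_ratio_nat N a : \pi(N).-nat a -> smooth_ratio N a%:R.
Proof. by move=> aN; exists a, 1%N; rewrite divr1. Qed.

Lemma smooth_ratioM N r s :
  smooth_ratio N r -> smooth_ratio N s -> smooth_ratio N (r * s).
Proof.
move=> [a [b [aN bN ->]]] [c [d [cN dN ->]]]; exists (a * c)%N, (b * d)%N.
by rewrite !pnatM aN bN cN dN; split => //; rewrite !natrM mulf_div.
Qed.

Lemma smooth_ratioV N r : smooth_ratio N r -> smooth_ratio N r^-1.
Proof. by move=> [a [b [aN bN ->]]]; exists b, a; rewrite invf_div. Qed.

Lemma smooth_ratio_exprz N r (k : int) : smooth_ratio N r -> smooth_ratio N (r ^ k).
Proof.
move=> rN; have H (m : nat) : smooth_ratio N (r ^+ m).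
  by elim: m => [|m IH]; [apply: (smooth_ratio_nat (a := 1%N)) |
     rewrite exprS; apply: smooth_ratioM].
by case: k => m; [apply: H | apply: (smooth_ratioV (H m.+1))].
Qed.

Lemma smooth_ratio_base N (k : int) : (0 < N)%N -> smooth_ratio N (N%:R ^ k).
Proof.
move=> N0; apply/smooth_ratio_exprz/smooth_ratio_nat/pnat_dvd_pi => //.
Qed.

Lemma smooth_ratio_trans N N' r :
  \pi(N).-nat N' -> smooth_ratio N' r -> smooth_ratio N r.
Proof.
move=> N'N [a [b [aN' bN' ->]]]; exists a, b.
by split => //; apply: pnat_trans N'N _.
Qed.

(** * Residues of scaled configurations *)

Section Residue.
Variable N : nat.
Hypothesis N_gt0 : (0 < N)%N.
Implicit Types (x y : conf N) (r : rat).

Lemma digit_lt x i : (digit x i < N)%N.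
Proof. by rewrite /digit; case: (x i : 'I__) => m /=; rewrite prednK. Qed.

Lemma digit_mkconf (f : int -> nat) i : (f i < N)%N -> digit (mkconf N f) i = f i.
Proof. by move=> fi; rewrite /digit /mkconf inordK ?prednK. Qed.

Lemma digit_inj x y : (forall i, digit x i = digit y i) -> x = y.
Proof. by move=> xy; apply/funext => i; apply/val_inj/xy. Qed.

(** Positions grow towards less significant digits, so [j] is the units place; for a represented
    number X this is floor (X N^j) mod N^k. *)
Definition word x (j : int) (k : nat) : nat :=
  (\sum_(i < k) digit x (j - i%:Z) * N ^ i)%N.

Lemma word_cat x j k e :
  word x j (k + e) = (word x (j - e%:Z) k * N ^ e + word x j e)%N.
Proof.
rewrite /word addnC big_split_ord /= addnC; congr addn.
rewrite big_distrl /=; apply: eq_bigr => i _.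
by rewrite PoszD opprD addrA -mulnA -expnD addnC.
Qed.

Lemma word0 x j : word x j 0 = 0%N. Proof. by rewrite /word big_ord0. Qed.

Lemma word1 x j : word x j 1 = digit x j.
Proof. by rewrite /word big_ord1 subr0 expn0 muln1. Qed.

Lemma word_lt x j k : (word x j k < N ^ k)%N.
Proof.
elim: k j => [|k IH] j; first by rewrite word0.
rewrite -[k.+1]addn1 word_cat word1 addn1 expn1 expnSr.
apply: leq_trans (_ : (word x (j - 1%:Z) k).+1 * N <= _)%N.
  by rewrite mulSn addnC ltn_add2r digit_lt.
by rewrite leq_mul2r IH orbT.
Qed.

Lemma word_div x j k e : (word x (j + e%:Z) (k + e) %/ N ^ e)%N = word x j k.
Proof.
by rewrite word_cat addrK divnMDl ?expn_gt0 ?N_gt0 // divn_small ?addn0 ?word_lt.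
Qed.

(* (j, k, t) tells how to read floor(x r) modulo s off the k digits of x ending
   at j: multiplying x by r is shifting it by j and dividing it by t. *)
Definition reading r s (p : int * nat * nat) : Prop :=
  [/\ (0 < p.2)%N, p.2%:R * r = N%:R ^ p.1.1 & (s * p.2 %| N ^ p.1.2)%N].

Definition read x s (p : int * nat * nat) : nat :=
  ((word x p.1.1 p.1.2 %/ p.2) %% s)%N.

(* The integer part of the number represented by x, multiplied by r, modulo s.
   The number may be infinite, but its residue is still well defined when r
   and s are N-smooth. *)
Definition residue x r s : nat := read x s (xget (0, 0%N, 0%N) (reading r s)).

(** The extra leading digits contribute a multiple of [N ^ k], hence of [s * t], which vanishes
    modulo [s] after the division by [t]. *)
Lemma read_lengthen x r s j k t e : reading r s (j, k, t) ->
  reading r s (j, (k + e)%N, t) /\ read x s (j, (k + e)%N, t) = read x s (j, k, t).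
Proof.
move=> [/= t0 tr stk]; split.
  by split => //=; rewrite expnD dvdn_mulr.
rewrite /read /= addnC word_cat.
move/dvdnP: stk => [c ->]; rewrite !mulnA divnMDl //.
by rewrite -modnDml modnMl add0n.
Qed.

(** Because [t * r = N ^ j], a reading that ends [e] places further right has [t' = N ^ e * t], so
    dividing by [t'] first drops the [e] extra trailing digits. Lengthening both windows to the left
    gives them a common start. *)
Lemma read_uniq x r s p q :
  smooth_ratio N r -> reading r s p -> reading r s q -> read x s p = read x s q.
Proof.
move=> /smooth_ratio_gt0 r0; move: p q => [[j k] t] [[j' k'] t'].
wlog jj' : j k t j' k' t' / j <= j'.
  move=> H; have [/H|/ltW/H] := leP j j'; first exact.
  by move=> H' A B; symmetry; apply: H'.
move=> P Q.
have [e ej] : exists e : nat, j' = j + e%:Z.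
  by exists `|j' - j|%N; lia.
rewrite {j' jj'}ej in Q *.
have [Q1 <-] := read_lengthen x (k + e) Q.
have [P1 <-] := read_lengthen x k' P.
have -> : (k' + (k + e) = k + k' + e)%N by lia.
case: P => /= t0 tr _; case: Q => /= t0' tr' _.
have {tr tr'}-> : t' = (N ^ e * t)%N.
  apply/eqP; rewrite -(eqr_nat rat) natrM natrX; apply/eqP.
  apply: (mulIf (lt0r_neq0 r0)); rewrite tr' expfzDr ?pnatr_eq0 -?lt0n //.
  by rewrite -mulrA tr -exprnP mulrC.
by rewrite /read /= divnMA word_div.
Qed.

Lemma residueE x r s j k t :
  smooth_ratio N r -> reading r s (j, k, t) ->
  residue x r s = (word x j k %/ t %% s)%N.
Proof.
move=> rN P; rewrite -[RHS]/(read x s (j, k, t)) /residue.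
by apply: (read_uniq _ rN _ P); apply: (@xgetPex _ _ (reading r s)); exists (j, k, t).
Qed.

(** For [r = a / b] and [N ^ j = c * a], the divisor [t = b * c] satisfies [t * r = N ^ j]; then [k]
    is taken so large that [s * t] divides [N ^ k]. *)
Lemma reading_exists r s : smooth_ratio N r -> \pi(N).-nat s ->
  exists j k t, [/\ reading r s (j, k, t) & \pi(N).-nat t].
Proof.
move=> [a [b [aN bN ->]]] sN.
have [j /dvdnP [c cj]] := pnat_dvd_exp N_gt0 aN.
have a0 := pnat_gt0 aN.
have b0 := pnat_gt0 bN.
have cN : \pi(N).-nat c.
  apply: (@pnat_dvd _ (N ^ j)%N); first by rewrite cj dvdn_mulr.
  by rewrite pnatX pnat_pi.
have [|k sk] := @pnat_dvd_exp N (s * (b * c)) N_gt0; first by rewrite !pnatM sN bN.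
exists j%:Z, k, (b * c)%N; split; last by rewrite pnatM bN.
split => //=; first by rewrite muln_gt0 b0 (pnat_gt0 cN).
rewrite -exprnP -natrX cj !natrM mulrC [a%:R / _]mulrC -mulrA [X in _ * X]mulrCA !mulrA.
by rewrite mulVf ?pnatr_eq0 -?lt0n // mul1r mulrC.
Qed.

Lemma residue_lt x r s : smooth_ratio N r -> \pi(N).-nat s ->
  (residue x r s < s)%N.
Proof.
move=> rN sN; have [j [k [t [P tN]]]] := reading_exists rN sN.
by rewrite (residueE x rN P) ltn_mod (pnat_gt0 sN).
Qed.

Lemma residue_mod x r s s' : smooth_ratio N r -> \pi(N).-nat s ->
  (s' %| s)%N -> (residue x r s %% s')%N = residue x r s'.
Proof.
move=> rN sN s's; have [j [k [t [P tN]]]] := reading_exists rN sN.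
rewrite (residueE x rN P) modn_dvdm //; symmetry; apply: residueE => //.
case: P => /= t0 tr st; split => //=.
by apply: dvdn_trans st; apply: dvdn_mul.
Qed.

(** A reading of [(r * t, s * t)] with divisor [u] is a reading of [(r, s)] with divisor [u * t]. *)
Lemma residue_div x r s t : smooth_ratio N r -> \pi(N).-nat s -> \pi(N).-nat t ->
  (residue x (r * t%:R) (s * t) %/ t)%N = residue x r s.
Proof.
move=> rN sN tN.
have rtN : smooth_ratio N (r * t%:R) by apply/smooth_ratioM/smooth_ratio_nat.
have stN : \pi(N).-nat (s * t)%N by rewrite pnatM sN.
have [j [k [u [P uN]]]] := reading_exists rtN stN.
rewrite (residueE x rtN P) -modn_divl -divnMA; symmetry; apply: residueE => //.
case: P => /= u0 ur stu; split => //=; first by rewrite muln_gt0 u0 (pnat_gt0 tN).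
  by rewrite natrM -ur -mulrA [t%:R * r]mulrC.
by rewrite [(u * t)%N]mulnC mulnA.
Qed.

Lemma residue_base x i k : residue x (N%:R ^ i) (N ^ k) = word x i k.
Proof.
rewrite (residueE x (j := i) (k := k) (t := 1%N)) ?divn1 ?modn_small ?word_lt //.
  exact: smooth_ratio_base.
by split => //=; rewrite ?mul1r ?muln1.
Qed.

Lemma residue_digit x i : residue x (N%:R ^ i) N = digit x i.
Proof. by rewrite -{2}[N]expn1 residue_base word1. Qed.

End Residue.

Lemma natr_base_neq0 N : (0 < N)%N -> N%:R != 0 :> rat.
Proof. by rewrite pnatr_eq0 lt0n. Qed.

(* The laws of (r, s) |-> floor (X r) mod s. *)
Definition residue_system N (G : rat -> nat -> nat) : Prop :=
  [/\ forall r s, smooth_ratio N r -> \pi(N).-nat s -> (G r s < s)%N,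
      forall r s s', smooth_ratio N r -> \pi(N).-nat s -> (s' %| s)%N ->
        (G r s %% s' = G r s')%N
    & forall r s t, smooth_ratio N r -> \pi(N).-nat s -> \pi(N).-nat t ->
        (G (r * t%:R)%R (s * t) %/ t = G r s)%N].

Section ResidueSystem.
Variables (N : nat) (G : rat -> nat -> nat).
Hypotheses (N_gt0 : (0 < N)%N) (sysG : residue_system N G).

(** Division with remainder by [t]: the division law yields the quotient, the reduction law the
    remainder. *)
Lemma residue_systemMr r s t :
  smooth_ratio N r -> \pi(N).-nat s -> \pi(N).-nat t ->
  G (r * t%:R) (s * t) = (G r s * t + G (r * t%:R)%R t)%N.
Proof.
case: sysG => _ Gmod Gdiv rN sN tN.
rewrite -(Gdiv _ _ _ rN sN tN) -(Gmod _ (s * t)%N t) ?dvdn_mull //.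
- exact: divn_eq.
- exact/smooth_ratioM/smooth_ratio_nat.
- by rewrite pnatM sN.
Qed.

(** Induction on the number of digits determines [G] at powers of [N] modulo powers of [N]. A
    reading [(j, k, t)] reduces any other [(r, s)] to this case, through the division law for [t]
    and reduction modulo [s]. *)
Lemma residue_system_unique (y : conf N) : (forall i, digit y i = G (N%:R ^ i) N) ->
  forall r s, smooth_ratio N r -> \pi(N).-nat s -> residue y r s = G r s.
Proof.
move=> yG r s rN sN; case: (sysG) => Glt Gmod Gdiv.
have iN i : smooth_ratio N (N%:R ^ i) by apply: smooth_ratio_base.
have NN : \pi(N).-nat N by rewrite pnat_pi.
have kN k : \pi(N).-nat (N ^ k)%N by rewrite pnatX NN.
have W k i : word y i k = G (N%:R ^ i) (N ^ k).
  elim: k i => [|k IH] i.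
    by rewrite word0; apply/esym/eqP; rewrite -leqn0 -ltnS Glt.
  rewrite -addn1 word_cat word1 addn1 !expn1 expnSr.
  have E : N%:R ^ i = N%:R ^ (i - 1) * N%:R :> rat.
    by rewrite -{3}[N%:R]expr1z -expfzDr ?subrK ?natr_base_neq0.
  by rewrite {1}E residue_systemMr // IH yG -E.
have [j [k [t [P tN]]]] := reading_exists N_gt0 rN sN.
rewrite (residueE N_gt0 y rN P) W; case: P => /= t0 <- /dvdnP[c ck].
have cN : \pi(N).-nat c.
  by apply: (@pnat_dvd _ (N ^ k)%N); rewrite ?kN // ck dvdn_mulr.
rewrite ck mulnA [t%:R * _]mulrC Gdiv ?pnatM ?cN //.
by rewrite Gmod ?dvdn_mull // pnatM cN.
Qed.

End ResidueSystem.

Lemma residue_is_system N N' al (x : conf N) :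
  (0 < N)%N -> \pi(N).-nat N' -> smooth_ratio N al ->
  residue_system N' (fun r => residue x (r * al)).
Proof.
move=> N0 N'N alN.
have rN r : smooth_ratio N' r -> smooth_ratio N (r * al).
  by move=> rN'; apply: smooth_ratioM alN; apply: smooth_ratio_trans rN'.
split=> [r s /rN rN' sN'|r s s' /rN rN' sN' s's|r s t /rN rN' sN' tN'].
- by rewrite residue_lt // (pnat_trans N'N).
- by rewrite residue_mod // (pnat_trans N'N).
- by rewrite mulrAC residue_div // (pnat_trans N'N).
Qed.

(** * Rescaling *)

Section Transfer.
Variables (N N' : nat).
Hypotheses (N_gt0 : (0 < N)%N) (N'_gt0 : (0 < N')%N) (N'N : \pi(N).-nat N').

(** In terms of represented numbers, [y] expands in base [N'] the product of [al] and the number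
    that [x] expands in base [N]. *)
Definition rescaled (al : rat) (x : conf N) (y : conf N') : Prop :=
  forall r s, smooth_ratio N' r -> \pi(N').-nat s ->
    residue y r s = residue x (r * al) s.

Lemma digit_rescaled (al : rat) (x : conf N) (y : conf N') : smooth_ratio N al ->
  (forall i, digit y i = residue x (N'%:R ^ i * al) N') -> rescaled al x y.
Proof.
move=> alN yx r s rN' sN'.
exact: (residue_system_unique N'_gt0 (residue_is_system x N_gt0 N'N alN)).
Qed.

Definition rescale (al : rat) (x : conf N) : conf N' :=
  mkconf N' (fun i => residue x (N'%:R ^ i * al) N').

Lemma digit_rescale al x i : smooth_ratio N al ->
  digit (rescale al x) i = residue x (N'%:R ^ i * al) N'.
Proof.
move=> alN; rewrite digit_mkconf // residue_lt //.
by apply: smooth_ratioM alN; apply/(smooth_ratio_trans N'N)/smooth_ratio_base.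
Qed.

Lemma rescaleP al x : smooth_ratio N al -> rescaled al x (rescale al x).
Proof. by move=> alN; apply: digit_rescaled => // i; apply: digit_rescale. Qed.

(** Each digit is itself a residue, at [N' ^ i] modulo [N'], so residues leave no freedom.
    Equalities between maps are proved through this uniqueness. *)
Lemma rescaled_eq al x y : smooth_ratio N al -> rescaled al x y -> y = rescale al x.
Proof.
move=> alN xy; apply: digit_inj => i; rewrite digit_rescale //.
by rewrite -xy ?pnat_pi ?residue_digit //; apply: smooth_ratio_base.
Qed.

End Transfer.

Lemma rescaled_comp N1 N2 N3 a b (x : conf N1) (y : conf N2) (z : conf N3) :
  \pi(N2).-nat N3 -> smooth_ratio N2 b ->
  rescaled a x y -> rescaled b y z -> rescaled (b * a) x z.
Proof.
move=> N32 bN xy yz r s rN sN; rewrite mulrA -xy ?yz //.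
  by apply: smooth_ratioM bN; apply: smooth_ratio_trans rN.
exact: pnat_trans sN.
Qed.

Lemma rescaled_sym N1 N2 a (x : conf N1) (y : conf N2) :
  \pi(N2).-nat N1 -> smooth_ratio N2 a ->
  rescaled a x y -> rescaled a^-1 y x.
Proof.
move=> N12 aN xy r s rN sN; have a0 := lt0r_neq0 (smooth_ratio_gt0 aN).
rewrite xy ?divfK //; last exact: pnat_trans sN.
by apply: smooth_ratioM (smooth_ratioV aN); apply: smooth_ratio_trans rN.
Qed.

(* Only surjectivity of F matters: any preimage of y is a rescaling of y. *)
Lemma inv_map_rescaled N N' a (F : conf N -> conf N') :
  (0 < N)%N -> (0 < N')%N -> \pi(N).-nat N' -> \pi(N').-nat N -> smooth_ratio N a ->
  (forall x, rescaled a x (F x)) -> forall y, rescaled a^-1 y (inv_map F y).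
Proof.
move=> N0 N'0 N'N NN' aN FP y; have aN' := smooth_ratio_trans NN' aN.
have Fy : F (inv_map F y) = y.
  apply: pinvK; apply/mem_set; exists (rescale N a^-1 y) => //.
  rewrite [LHS](rescaled_eq N0 N'0 N'N aN (FP _)); symmetry.
  apply: rescaled_eq => //; rewrite -[a]invrK; apply: rescaled_sym => //.
    exact: smooth_ratioV.
  by rewrite ?invrK; apply: rescaleP => //; apply: smooth_ratioV.
by rewrite -{1}Fy; apply: rescaled_sym => //; apply: FP.
Qed.

(** * Multiplication automata as rescalings *)

(** Multiplication by [p] is a shift by one digit followed by division by [q]; the local rule thus
    yields the last digit of the two-digit word [a * N + b] divided by [q]. *)
Lemma g_mul_word N p q a b : (0 < q)%N -> N = (q * p)%N -> (b < N)%N ->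
  (a %% q * p + b %/ q = (a * N + b) %/ q %% N)%N.
Proof.
move=> q0 -> b_lt; have p0 : (0 < p)%N by case: p b_lt; rewrite ?muln0.
have -> : ((a * (q * p) + b) %/ q = a * p + b %/ q)%N.
  by rewrite mulnCA mulnC divnMDl.
rewrite {2}(divn_eq a q) mulnDl -mulnA -addnA modnMDl [RHS]modn_small //.
apply: (@leq_trans ((a %% q).+1 * p)%N); last by rewrite leq_mul2r ltn_pmod ?orbT.
by rewrite mulSn addnC ltn_add2r ltn_divLR // mulnC.
Qed.

Section PiRescaled.
Variable N : nat.
Hypothesis N_gt0 : (0 < N)%N.
Implicit Types (x : conf N) (al : rat).

Lemma pos_divisor_pnat p : pos_divisor N p -> \pi(N).-nat p.
Proof. by case/andP => _; apply: pnat_dvd_pi. Qed.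

Lemma prod_pos_divisor_pnat s :
  all (pos_divisor N) s -> \pi(N).-nat (\prod_(p <- s) p)%N.
Proof.
elim: s => [|p s IH] /=; first by rewrite big_nil.
by move=> /andP[/pos_divisor_pnat pN /IH sN]; rewrite big_cons pnatM pN.
Qed.

Lemma Pi_div_rescaled p x : pos_divisor N p -> rescaled p%:R x (Pi_div N p x).
Proof.
move=> pN; have pi_p := pos_divisor_pnat pN.
case/andP: pN => p0 /dvdnP[q Nq].
have q0 : (0 < q)%N by move: N_gt0; rewrite Nq muln_gt0 => /andP[].
have NN : \pi(N).-nat N by rewrite pnat_pi.
apply: digit_rescaled => // [|i]; first exact: smooth_ratio_nat.
(* As [q * (N ^ i * p) = N ^ (i + 1)], the residue is read off the digits at [i] and [i + 1], which
   are the arguments of the local rule. *)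
have rd : reading N (N%:R ^ i * p%:R) N (i + 1%:Z, (1 + 1)%N, q).
  split => //=; last by rewrite addn1 expnS expn1 dvdn_mul // Nq dvdn_mulr.
  rewrite mulrC -mulrA -natrM mulnC -Nq expfzDr ?natr_base_neq0 // expr1z.
rewrite (residueE _ _ _ rd) //; last first.
  by apply: smooth_ratioM; [apply: smooth_ratio_base | apply: smooth_ratio_nat].
rewrite word_cat !word1 addrK expn1.
have [a_lt b_lt] : (digit x i < N)%N /\ (digit x (i + 1%:Z) < N)%N by rewrite !digit_lt.
have Npq : (N %/ p)%N = q by rewrite Nq mulnK.
have E : g_mul p N (digit x i) (digit x (i + 1%:Z)) =
         ((digit x i * N + digit x (i + 1%:Z)) %/ q %% N)%N.
  by rewrite /g_mul Npq (g_mul_word _ q0 Nq b_lt).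
by rewrite digit_mkconf // E ltn_mod.
Qed.

Lemma Pi_comp_rescaled al pq x : Pi_decomp N al pq ->
  rescaled al x (Pi_comp pq x).
Proof.
have NN : \pi(N).-nat N by rewrite pnat_pi.
case: pq => ps qs [/= psN qsN ->]; rewrite /Pi_comp /=.
set y := foldr _ _ qs x.
have y_q : rescaled (\prod_(q <- qs) q)%N%:R^-1 x y.
  rewrite {}/y; elim: qs qsN => [|q qs IH] /=.
    by rewrite big_nil invr1 => _ r s _ _; rewrite mulr1.
  move=> /andP[qN qsN]; rewrite big_cons natrM invfM.
  have qN' := smooth_ratio_nat (pos_divisor_pnat qN).
  apply: rescaled_comp (IH qsN) _ => //; first exact: smooth_ratioV.
  by apply: inv_map_rescaled => // z; apply: Pi_div_rescaled.
have p_y : rescaled (\prod_(p <- ps) p)%N%:R y (foldr (fun p F => Pi_div N p \o F) id ps y).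
  elim: ps psN => [|p ps IH] /=.
    by rewrite big_nil => _ r s _ _; rewrite mulr1.
  move=> /andP[pN psN]; rewrite big_cons natrM.
  apply: rescaled_comp (IH psN) (Pi_div_rescaled _ pN) => //.
  exact/smooth_ratio_nat/pos_divisor_pnat.
by apply: rescaled_comp y_q p_y => //; apply/smooth_ratio_nat/prod_pos_divisor_pnat.
Qed.

Lemma Pi_rescaled al x : Pi_defined N al -> rescaled al x (Pi N al x).
Proof.
by move=> [pq al_pq]; apply: Pi_comp_rescaled; apply: (@xgetPex _ _ (Pi_decomp N al)); exists pq.
Qed.

Lemma Pi_defined_smooth al : Pi_defined N al -> smooth_ratio N al.
Proof.
by move=> [[ps qs] [/= psN qsN ->]]; exists (\prod_(p <- ps) p)%N, (\prod_(q <- qs) q)%N;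
  split => //; apply: prod_pos_divisor_pnat.
Qed.

Lemma Pi_defined_divisor p : pos_divisor N p -> Pi_defined N p%:R.
Proof.
by move=> pN; exists ([:: p], [::]); split; rewrite /= ?pN // big_nil big_seq1 divr1.
Qed.

Lemma Pi_definedM al be : Pi_defined N al -> Pi_defined N be ->
  Pi_defined N (al * be).
Proof.
move=> [[p q] [/= pN qN ->]] [[p' q'] [/= p'N q'N ->]].
exists (p ++ p', q ++ q'); split; rewrite /= ?all_cat ?pN ?p'N ?qN ?q'N //.
by rewrite !big_cat /= !natrM mulf_div.
Qed.

Lemma Pi_definedV al : Pi_defined N al -> Pi_defined N al^-1.
Proof.
by move=> [[p q] [/= pN qN ->]]; exists (q, p); split => //=; rewrite invf_div.
Qed.

Lemma Pi_defined_alpha d (n : 'I_d -> nat) (z : vec d) :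
  (forall i, n i %| N)%N -> Pi_defined N (alpha_ z n).
Proof.
move=> nN; have one : Pi_defined N 1 by exists ([::], [::]); rewrite /Pi_decomp !big_nil divr1.
apply: (big_ind (Pi_defined N)) => // [|i _]; first exact: Pi_definedM.
have ni : Pi_defined N (n i)%:R.
  by apply: Pi_defined_divisor; rewrite /pos_divisor nN (dvdn_gt0 N_gt0).
have H (m : nat) : Pi_defined N ((n i)%:R ^+ m).
  by elim: m => // m IH; rewrite exprS; apply: Pi_definedM.
by case: (z i ord0) => m; [apply: H | apply: (Pi_definedV (H m.+1))].
Qed.

End PiRescaled.

(** * Cubes and labels of tessellations *)

Section Boxes.
Variables (d : nat) (n : 'I_d -> nat).
Hypothesis n_gt0 : forall i, (0 < n i)%N.
Implicit Types u v w z : vec d.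

Lemma vleP u v : reflect (forall i, u i ord0 <= v i ord0) (vle u v).
Proof. exact: forallP. Qed.

Lemma vle_subr u v : vle u v = vle 0 (v - u).
Proof. by apply: eq_forallb => i; rewrite !mxE subr_ge0. Qed.

Lemma vle_addr u v w : vle u v -> vle 0 w -> vle u (v + w).
Proof.
move=> /vleP uv /vleP w0; apply/vleP => i; rewrite mxE -[u i ord0]addr0.
by apply: lerD => //; have := w0 i; rewrite mxE.
Qed.

Lemma alphaD u v : alpha_ (u + v) n = alpha_ u n * alpha_ v n.
Proof.
rewrite -big_split; apply: eq_bigr => i _ /=.
by rewrite mxE expfzDr // natr_base_neq0.
Qed.

Lemma alpha0 : alpha_ 0 n = 1.
Proof. by apply: big1 => i _; rewrite mxE expr0z. Qed.

Lemma alpha_neq0 z : alpha_ z n != 0.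
Proof. by apply/prodf_neq0 => i _; rewrite expfz_neq0 // natr_base_neq0. Qed.

Lemma alphaN z : alpha_ (- z) n = (alpha_ z n)^-1.
Proof.
by apply: (mulIf (alpha_neq0 z)); rewrite -alphaD addNr alpha0 mulVf ?alpha_neq0.
Qed.

Lemma m_alpha z : m_ n z = (alpha_ z n)^-1.
Proof. by rewrite -alphaN; apply: eq_bigr => i _; rewrite mxE. Qed.

Lemma alpha_e i : alpha_ (e_ i) n = (n i)%:R.
Proof.
rewrite /alpha_ (bigD1 i) //= big1 ?mulr1 => [|j ji]; first by rewrite mxE !eqxx expr1z.
by rewrite mxE (negPf ji) expr0z.
Qed.

Lemma alpha_allc k : alpha_ (allc k) n = (\prod_i n i)%N%:R ^ k.
Proof.
rewrite /alpha_ (eq_bigr (fun i => (n i)%:R ^ k)); last by move=> i _; rewrite mxE.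
rewrite natr_prod; elim/big_rec2: _ => [|i y1 y2 _ ->]; first by rewrite exp1rz.
by rewrite expfzMl.
Qed.

(** The value of [alpha_ v n] as a natural number when [v] has no negative entry; the absolute value
    only turns exponents into naturals. *)
Definition box v : nat := (\prod_i n i ^ `|v i ord0|)%N.

Lemma alpha_box v : vle 0 v -> alpha_ v n = (box v)%:R.
Proof.
move=> /vleP v0; rewrite /box natr_prod; apply: eq_bigr => i _.
by rewrite natrX exprnP gez0_abs //; have := v0 i; rewrite mxE.
Qed.

Lemma box_gt0 v : (0 < box v)%N.
Proof. by apply: prodn_gt0 => i; rewrite expn_gt0 n_gt0. Qed.

Lemma boxD u v : vle 0 u -> vle 0 v -> box (u + v) = (box u * box v)%N.
Proof.
move=> u0 v0; apply/eqP; rewrite -(eqr_nat rat) natrM -!alpha_box ?alphaD //.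
exact: vle_addr.
Qed.

Lemma box_e i : box (e_ i) = n i.
Proof.
apply/eqP; rewrite -(eqr_nat rat) -alpha_box ?alpha_e //.
by apply/vleP => j; rewrite !mxE; case: (_ && _).
Qed.

Lemma vle0e i : vle 0 (e_ i : vec d).
Proof. by apply/vleP => j; rewrite !mxE; case: (_ && _). Qed.

Lemma vle0_allc (k : nat) : vle 0 (allc k%:Z : vec d).
Proof. by apply/vleP => j; rewrite !mxE. Qed.

Lemma box_allc1 : box (allc 1) = (\prod_i n i)%N.
Proof. by apply: eq_bigr => i _; rewrite mxE expn1. Qed.

(** The representation is a mixed-radix expansion with place values 1, [box u] and [box u * box w],
    and such expansions are unique. *)
Lemma base2E a u w : vle 0 u -> vle 0 w ->
  base2 n a (- u) (- u - w) = (a %/ box u %% box w)%N.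
Proof.
move=> u0 w0; have bu := box_gt0 u; have bw := box_gt0 w.
have mu : m_ n (- u) = (box u)%:R by rewrite m_alpha alphaN invrK alpha_box.
have muw : m_ n (- u - w) = (box u * box w)%:R.
  rewrite m_alpha -opprD alphaN invrK alphaD !alpha_box //.
  by rewrite natrM.
have quot : (box u * box w)%:R / (box u)%:R = (box w)%:R :> rat.
  by rewrite natrM mulrC mulKf // natr_base_neq0.
apply: xget_unique => [|b /=].
  exists (a %% box u)%N, (a %/ box u %/ box w)%N; split.
  - rewrite mu muw -!natrM -!natrD; congr (_%:R).
    rewrite {1}(divn_eq a (box u)) {1}(divn_eq (a %/ box u) (box w)); ring.
  - by rewrite mu ltr_nat ltn_mod.
  - by rewrite muw mu quot ltr_nat ltn_mod.
move=> [a0 [a2 [+ + +]]]; rewrite muw mu quot -!natrM -!natrD !ltr_nat.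
move=> /eqP; rewrite eqr_nat => /eqP -> a0u bw'.
have -> : (a0 + b * box u + a2 * (box u * box w) =
           (a2 * box w + b) * box u + a0)%N by ring.
by rewrite divnMDl // divn_small // addn0 modnMDl modn_small.
Qed.

Lemma cube_dom0 w : vle (allc (- 1)) (- w) -> vle 0 w -> cube_dom (allc 0) (- w).
Proof.
move=> w1 /vleP w0; apply/and3P; split => //; apply/vleP => i; rewrite !mxE //.
by rewrite oppr_le0; have := w0 i; rewrite mxE.
Qed.

Lemma cube0E a w : vle (allc (- 1)) (- w) -> vle 0 w ->
  cube n a (allc 0) (- w) = (a %% box w)%N.
Proof.
move=> w1 w0; rewrite /cube cube_dom0 //.
have -> : allc 0 = - 0 :> vec d by apply/matrixP => i j; rewrite !mxE oppr0.
rewrite -[- w]add0r -{2}oppr0 base2E //; last by apply/vleP => i; rewrite mxE.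
by rewrite /box big1 ?divn1 // => i _; rewrite mxE.
Qed.

Lemma val_cube a : val_ (cube n a) = (a %% \prod_i n i)%N.
Proof.
rewrite /val_ (_ : allc (- 1) = - allc 1); last by apply/matrixP => i j; rewrite !mxE.
rewrite cube0E ?box_allc1 //; first by apply/vleP => i; rewrite !mxE.
exact: (vle0_allc 1).
Qed.

End Boxes.

(** * Labels of tessellations as differences of a potential *)

Section TessLabels.
Variables (N d : nat) (n : 'I_d -> nat) (x : conf N).
Hypotheses (N_gt0 : (0 < N)%N) (nN : forall i, (n i %| N)%N).
Implicit Types b p q u w z : vec d.

Local Notation f := (tess N n x).

Let n_gt0 i : (0 < n i)%N. Proof. exact: dvdn_gt0 (nN i). Qed.

Lemma alpha_smooth z : smooth_ratio N (alpha_ z n).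
Proof. exact/Pi_defined_smooth/Pi_defined_alpha. Qed.

Lemma box_smooth z : \pi(N).-nat (box n z).
Proof.
by apply: (big_ind (fun m => \pi(N).-nat m)) => // [a b aN bN|i _];
  rewrite ?pnatM ?aN // pnatX pnat_dvd_pi.
Qed.

Lemma tessE z : f z = cube n (residue x (alpha_ z n) N).
Proof.
rewrite /tess -residue_digit // (Pi_rescaled N_gt0) ?pnat_pi ?mul1r //.
  exact: Pi_defined_alpha.
exact: smooth_ratio_base.
Qed.

Lemma edge_label_tess z i : edge_label f z i = residue x (alpha_ z n) (n i).
Proof.
rewrite /edge_label tessE cube0E ?vle0e // ?box_e //; last first.
  by apply/vleP => j; rewrite !mxE; case: (_ && _).
by rewrite residue_mod ?pnat_pi //; apply: alpha_smooth.
Qed.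

(* For a configuration representing a finite number X, m_ n p * floor (X * alpha p)
   would be a potential for the labels. In general only its differences make
   sense, which is why it is computed modulo 1 / alpha b for some b below
   the points under consideration. *)
Definition potential b p : rat :=
  m_ n p * (residue x (alpha_ p n) (box n (p - b)))%:R.

Lemma residue_addv p w b : vle 0 (p - b) -> vle 0 w ->
  residue x (alpha_ (p + w) n) (box n (p + w - b)) =
  (residue x (alpha_ p n) (box n (p - b)) * box n w
   + residue x (alpha_ (p + w) n) (box n w))%N.
Proof.
move=> pb w0; rewrite addrAC (boxD n_gt0 pb w0) alphaD // (alpha_box n w0).
have sysx : residue_system N (residue x).
  by split=> *; [apply: residue_lt | apply: residue_mod | apply: residue_div].
by rewrite (residue_systemMr sysx) ?box_smooth //; apply: alpha_smooth.
Qed.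

(** By [residue_addv] the residue at [p + w] has the one at [p] as leading part, which contributes
    exactly [potential b p]; the remainder no longer depends on [b]. *)
Lemma potential_diff b p w : vle 0 (p - b) -> vle 0 w ->
  potential b (p + w) - potential b p =
  m_ n (p + w) * (residue x (alpha_ (p + w) n) (box n w))%:R.
Proof.
move=> pb w0; rewrite /potential residue_addv // natrD mulrDr natrM.
have -> : m_ n p = m_ n (p + w) * (box n w)%:R.
  rewrite !m_alpha // alphaD // (alpha_box n w0) invfM mulfVK //.
  by rewrite natr_base_neq0 // box_gt0.
by rewrite [_ * (box n w)%:R]mulrC mulrA [X in X - _]addrC addrK.
Qed.

Lemma step_val_potential b p p' : unit_step p p' -> vle b p -> vle b p' ->
  step_val n f p p' = potential b p' - potential b p.
Proof.
(* Basis vectors and their opposites are pairwise distinct, so a single summand of [step_val]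
   survives. *)
have e_inj (i j : 'I_d) : (e_ i == e_ j :> vec d) = (i == j).
  apply/eqP/eqP => [/matrixP /(_ i ord0)|-> //]; rewrite !mxE !eqxx /= andbT.
  by case: eqVneq.
have e_opp (i j : 'I_d) : (- e_ i == e_ j :> vec d) = false.
  by apply/negP => /eqP/matrixP /(_ i ord0); rewrite !mxE !eqxx /=; case: (_ == _).
move=> /existsP[j /orP[/eqP pp|/eqP pp]] bp bp'.
  rewrite /step_val (bigD1 j) //= pp eqxx big1 ?addr0 => [|k kj]; last first.
    by rewrite -opprB pp e_inj e_opp eq_sym (negPf kj).
  have -> : p' = p + e_ j by rewrite -pp addrC subrK.
  by rewrite potential_diff ?vle0e -?vle_subr // box_e // edge_label_tess.
rewrite /step_val (bigD1 j) //= -opprB pp e_opp eqxx big1 ?addr0 => [|k kj]; last first.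
  by rewrite e_inj e_opp eq_sym (negPf kj).
have -> : p = p' + e_ j by rewrite -pp addrC subrK.
rewrite -opprB potential_diff ?vle0e -?vle_subr //.
by rewrite box_e // edge_label_tess.
Qed.

Lemma path_val_potential b p s : path unit_step p s -> all (vle b) (p :: s) ->
  path_val n f p s = potential b (last p s) - potential b p.
Proof.
elim: s p => [|q s IH] p /=; first by rewrite subrr.
move=> /andP[pq qs] /and3P[bp bq bs].
rewrite (step_val_potential pq bp bq) IH //=; last by rewrite bq.
by rewrite addrC addrA subrK.
Qed.

(** Needed because the choice in [pair_val] falls back to the empty path when no path exists. Each
    upward unit step lowers the l1 distance to [w]. *)
Lemma unit_path_exists u w : vle u w ->
  exists s, path unit_step u s /\ last u s = w.
Proof.
have [k] := ubnP (\sum_i `|w i ord0 - u i ord0|)%N.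
elim: k u => // k IH u hk uw.
have [->|/eqP] := eqVneq u w; first by exists [::].
move=> uw'; have [i ui] : exists i, u i ord0 != w i ord0.
  apply/existsP; rewrite -negb_forall; apply/negP => /forallP uw0; apply: uw'.
  by apply/matrixP => i j; rewrite ord1; apply/eqP.
have uiw : u i ord0 < w i ord0 by rewrite lt_neqAle ui; apply/vleP.
have [||s [us lsw]] := IH (u + e_ i).
- rewrite (bigD1 i) //= in hk; rewrite (bigD1 i) //=.
  rewrite (eq_bigr (fun j => `|w j ord0 - u j ord0|%N)) => [|j ji]; last first.
    by rewrite !mxE (negPf ji) addr0.
  rewrite !mxE !eqxx /=; move: hk uiw; set S := (\sum_(j < d | _) _)%N; lia.
- apply/vleP => j; rewrite !mxE; have [->|ji] := eqVneq j i; first by rewrite /= lezD1.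
  by rewrite addr0; apply/vleP.
exists (u + e_ i :: s); split => //=; rewrite us andbT.
by apply/existsP; exists i; rewrite addrC addKr eqxx.
Qed.

(** The path chosen by [pair_val] may leave the box between its end points, so the base point of the
    potential must lie below all of its vertices. *)
Lemma lower_bound_exists (s : seq (vec d)) : exists b, all (vle b) s.
Proof.
elim: s => [|p s [b bs]]; first by exists 0.
exists (\col_i Num.min (p i ord0) (b i ord0)) => /=; apply/andP; split.
  by apply/vleP => i; rewrite mxE ge_min lexx.
apply: sub_all bs => q /vleP bq; apply/vleP => i.
by rewrite mxE ge_min bq orbT.
Qed.

(** The potential telescopes along the chosen path, whichever it is, and dividing by [m_ n w] leaves
    the residue at the end point. *)
Lemma label_tess u w : vle u w ->
  label n f u w = (residue x (alpha_ w n) (box n (w - u)))%:R.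
Proof.
move=> uw; rewrite /label /pair_val; set P := [set s | _]%classic.
have [us lsw] : P (xget [::] P) by apply: xgetPex; apply: unit_path_exists.
have [b ball] := lower_bound_exists (u :: xget [::] P).
rewrite (path_val_potential us ball) lsw.
have bu : vle 0 (u - b) by case/andP: ball; rewrite vle_subr.
have := uw; rewrite vle_subr => /(potential_diff bu).
rewrite [u + _]addrC subrK => ->; rewrite mulrC mulKf //.
by rewrite m_alpha // invr_eq0 alpha_neq0.
Qed.

End TessLabels.

(** * Macrotiles and microtiles of tessellations *)

Section TileMaps.
Variables (N d d' : nat) (n : 'I_d -> nat) (A : 'M[nat]_(d, d')) (x : conf N).
Hypotheses (N_gt0 : (0 < N)%N) (nN : forall i, (n i %| N)%N).

Local Notation n' := (prebasis_exp n A).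

Let n_gt0 i : (0 < n i)%N. Proof. exact: dvdn_gt0 (nN i). Qed.

Lemma matvecE (v : vec d') i :
  matvec A v i ord0 = \sum_j (A i j)%:Z * v j ord0.
Proof. by rewrite mxE; apply: eq_bigr => j _; rewrite mxE. Qed.

Lemma matvecB (u v : vec d') : matvec A (u - v) = matvec A u - matvec A v.
Proof. exact: mulmxBr. Qed.

Lemma matvec_ge0 (v : vec d') : vle 0 v -> vle 0 (matvec A v).
Proof.
move=> /vleP v0; apply/vleP => i; rewrite matvecE mxE; apply: sumr_ge0 => j _.
by apply: mulr_ge0 => //; have := v0 j; rewrite mxE.
Qed.

Lemma alpha_matvec (v : vec d') : alpha_ (matvec A v) n = alpha_ v n'.
Proof.
rewrite /alpha_ [RHS](eq_bigr (fun j => \prod_i (n i)%:R ^ ((A i j)%:Z * v j ord0))).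
  rewrite exchange_big; apply: eq_bigr => i _ /=; rewrite matvecE.
  apply: (big_morph (fun k : int => (n i)%:R ^ k : rat)) => // a b.
  by rewrite expfzDr // natr_base_neq0.
move=> j _; rewrite natr_prod.
elim/big_rec2: _ => [|i y1 y2 _ <-]; first by rewrite exp1rz.
by rewrite expfzMl natrX exprnP exprz_exp.
Qed.

Lemma box_matvec (v : vec d') : vle 0 v -> box n (matvec A v) = box n' v.
Proof.
move=> v0; apply/eqP; rewrite -(eqr_nat rat) -!alpha_box //.
- by rewrite alpha_matvec.
- exact: matvec_ge0.
Qed.

(** The label runs over the box with diagonal [A 1] and top corner [A v]; at that corner [alpha_]
    for [n] equals [alpha_ v n'], and the box size is the product of the entries of [n']. *)
Lemma macro_tess v :
  macro A n (tess N n x) v = cube n' (residue x (alpha_ v n') (\prod_j n' j)).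
Proof.
have v1 : vle 0 (v - (v - allc 1)) by rewrite opprB addrC subrK (vle0_allc _ 1).
rewrite /macro label_tess //; last by rewrite vle_subr -matvecB matvec_ge0.
rewrite natrK -matvecB opprB addrC subrK box_matvec ?(vle0_allc _ 1) //.
by rewrite box_allc1 alpha_matvec.
Qed.

Lemma micro_choice_exists (z : vec d) : (forall i, exists j, (0 < A i j)%N) ->
  exists u, micro_choice A z u.
Proof.
(* A row with a positive entry sends the constant vector [K] to at least [K], which bounds every
   entry of [z] in absolute value; the [+ 1] pays for the shift by [allc 1]. *)
move=> Apos; set K := (\sum_i `|z i ord0| + 1)%N.
have zK i : z i ord0 <= K%:Z /\ 1 - z i ord0 <= K%:Z.
  have : (`|z i ord0| + 1 <= K)%N by rewrite leq_add2r (bigD1 i) //= leq_addr.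
  by move: (z i ord0) K => a b; lia.
have AK i : K%:Z <= \sum_j (A i j)%:Z * K%:Z.
  have [j Aj] := Apos i; rewrite (bigD1 j) //= -[X in X <= _]addr0.
  apply: lerD; last by apply: sumr_ge0.
  by rewrite -PoszM lez_nat leq_pmull.
have A_allc k i : matvec A (allc k) i ord0 = \sum_j (A i j)%:Z * k.
  by rewrite matvecE; apply: eq_bigr => j _; rewrite mxE.
exists (allc K, allc (- K%:Z)); split => /=.
- apply/vleP => i; rewrite [X in _ <= X]mxE [X in _ + X]mxE A_allc mxE subr_ge0.
  by apply: le_trans (AK i); have [] := zK i.
- by apply/vleP => i; rewrite !mxE; lia.
- apply/vleP => i; rewrite A_allc !mxE.
  rewrite (eq_bigr (fun j => - ((A i j)%:Z * K%:Z))) => [|j _]; last by rewrite mulrN.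
  rewrite sumrN lerNl opprB; apply: le_trans (AK i); by have [] := zK i.
Qed.

(** The label is a residue at [A z1 = z + v]; dividing by [box v] brings it down to [z], and
    reducing modulo the unit box isolates the tile. *)
Lemma micro_tess (z : vec d) :
  (forall i, exists j, (0 < A i j)%N) -> (forall j, (n' j %| N)%N) ->
  micro A n (tess N n' x) z = cube n (residue x (alpha_ z n) (\prod_i n i)).
Proof.
move=> Apos n'N; rewrite /micro; set u := xget _ _.
have [u1z u21 u2z] : micro_choice A z u.
  by apply: (@xgetPex _ _ (micro_choice A z)); apply: micro_choice_exists.
rewrite label_tess // natrK.
set v := matvec A u.1 - z in u1z *.
have w0 : vle 0 (z - allc 1 - matvec A u.2) by rewrite -vle_subr.
rewrite base2E ?(vle0_allc _ 1) // box_allc1 -box_matvec -?vle_subr //.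
(* The diagonal from [A z2] to [A z1] splits into the part [v] above [z], the unit cube just below
   [z], and the rest. *)
have -> : matvec A (u.1 - u.2) = allc 1 + (z - allc 1 - matvec A u.2) + v.
  by rewrite matvecB /v; apply/matrixP => i j; rewrite !mxE; ring.
rewrite -alpha_matvec.
have -> : matvec A u.1 = z + v by rewrite /v addrC subrK.
have one0 : vle 0 (allc 1 : vec d) by apply: (vle0_allc _ 1).
rewrite alphaD // (boxD n_gt0 (vle_addr one0 w0) u1z) (boxD n_gt0 one0 w0).
rewrite (alpha_box n u1z) residue_div ?pnatM ?(box_smooth N_gt0 nN) //; last exact: alpha_smooth.
rewrite residue_mod ?pnatM ?(box_smooth N_gt0 nN) // ?box_allc1 ?dvdn_mulr //.
exact: alpha_smooth.
Qed.

End TileMaps.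

(** On the diagonal [alpha_ (allc i) n = N' ^ i], so the values found there are precisely base-[N']
    digits. *)
Lemma diag_cube_rescaled N N' d (n : 'I_d -> nat) (f : tiling d) (x : conf N) :
  (0 < N)%N -> (0 < N')%N -> \pi(N).-nat N' -> (forall i, 0 < n i)%N ->
  N' = (\prod_i n i)%N ->
  (forall z, f z = cube n (residue x (alpha_ z n) (\prod_i n i))) ->
  rescaled 1 x (diag N' n f).
Proof.
move=> N0 N'0 N'N n0 N'E fE; apply: digit_rescaled => // [|i].
  exact: (smooth_ratio_nat (a := 1%N)).
have lt : (residue x (N'%:R ^ i) N' < N')%N.
  by apply: residue_lt => //; apply/(smooth_ratio_trans N'N)/smooth_ratio_base.
by rewrite mulr1 digit_mkconf // fE val_cube // alpha_allc // -N'E modn_small.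
Qed.

(** * Conj and Fact as rescalings *)

Local Notation rad := Defs.rad.

Lemma prime_basis_mem N i : prime_basis N i \in primes N.
Proof. exact: mem_nth. Qed.

Lemma prime_basis_gt0 N i : (0 < prime_basis N i)%N.
Proof. by have := prime_basis_mem i; rewrite mem_primes => /and3P[/prime_gt0]. Qed.

Lemma prime_basis_dvd N i : (prime_basis N i %| N)%N.
Proof. by have := prime_basis_mem i; rewrite mem_primes => /and3P[]. Qed.

Lemma prod_prime_basis N : (\prod_i prime_basis N i = rad N)%N.
Proof. by rewrite /rad (big_nth 0%N) big_mkord. Qed.

Lemma rad_gt0 N : (0 < rad N)%N.
Proof. by rewrite -prod_prime_basis prodn_gt0 // => i; apply: prime_basis_gt0. Qed.

Lemma primes_rad N : (0 < N)%N -> primes (rad N) = primes N.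
Proof.
move=> N0; apply/eq_primes => p; apply/idP/idP.
  rewrite mem_primes => /and3P[pp _].
  rewrite /rad Euclid_dvd_prod // big_has => /hasP[q qN].
  by have := qN; rewrite mem_primes => /and3P[qp _ _]; rewrite dvdn_prime2 // => /eqP ->.
move=> pN; have := pN; rewrite !mem_primes rad_gt0 => /and3P[-> _ _] /=.
by rewrite /rad (big_rem p) //= dvdn_mulr.
Qed.

Lemma rad_rad N : (0 < N)%N -> rad (rad N) = rad N.
Proof. by move=> N0; rewrite {1}/rad primes_rad. Qed.

Lemma pnat_primes N N' : (0 < N')%N -> {subset primes N' <= primes N} -> \pi(N).-nat N'.
Proof.
move=> N'0 sub; apply/pnatP => // p pp pN'.
by rewrite -topredE /= sub // mem_primes pp N'0.
Qed.

Lemma prebasis_exp_A_Conj N :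
  prebasis_exp (prime_basis N) (A_Conj N) = prime_power_basis N.
Proof.
apply/funext => i; rewrite /prebasis_exp (bigD1 i) //= big1 ?muln1 => [|j ji].
  by rewrite !mxE eqxx.
by rewrite !mxE (negPf ji).
Qed.

Lemma Conj_rad_rescaled N M x : (0 < N)%N -> M = rad N ->
  rescaled 1 x (Conj_rad N M x).
Proof.
move=> N0 ->; rewrite /Conj_rad -prebasis_exp_A_Conj.
apply: diag_cube_rescaled => //.
- exact: rad_gt0.
- by apply: pnat_primes (rad_gt0 _) _ => p; rewrite primes_rad.
- exact: prime_basis_gt0.
- by rewrite prod_prime_basis.
- move=> z; apply: micro_tess => // i.
  + exact: prime_basis_dvd.
  + by exists i; rewrite !mxE eqxx mulr1n logn_gt0 prime_basis_mem.
  + by rewrite prebasis_exp_A_Conj pfactor_dvdnn.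
Qed.

Lemma prebasis_exp_A_Fact M M' : {subset primes M' <= primes M} ->
  prebasis_exp (prime_basis M) (A_Fact M M') = prime_basis M'.
Proof.
move=> sub; apply/funext => j; rewrite /prebasis_exp.
have /(nthP 0%N)[k kM kj] := sub _ (prime_basis_mem j).
rewrite (bigD1 (Ordinal kM)) //= big1 ?muln1 => [|i ik].
  by rewrite mxE /prime_basis /= kj eqxx.
rewrite mxE -kj nth_uniq ?primes_uniq //.
by rewrite -[(i : nat) == k]/(i == Ordinal kM) (negPf ik).
Qed.

Lemma Fact_sqfree_rescaled M M' x : (0 < M)%N -> (0 < M')%N ->
  {subset primes M' <= primes M} -> rad M' = M' ->
  rescaled 1 x (Fact_sqfree M M' x).
Proof.
move=> M0 M'0 sub M'E; apply: diag_cube_rescaled => //.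
- exact: pnat_primes.
- exact: prime_basis_gt0.
- by rewrite prod_prime_basis.
- by move=> z; rewrite -(prebasis_exp_A_Fact sub) macro_tess // => i; apply: prime_basis_dvd.
Qed.

Lemma rescaled1_trans N1 N2 N3 (x : conf N1) (y : conf N2) (z : conf N3) :
  \pi(N2).-nat N3 -> rescaled 1 x y -> rescaled 1 y z -> rescaled 1 x z.
Proof.
move=> N32 xy yz; rewrite -[1]mulr1; apply: rescaled_comp xy yz => //.
exact: (smooth_ratio_nat (a := 1%N)).
Qed.

Lemma Conj_rescaled N N' x : (0 < N)%N -> (0 < N')%N -> primes N = primes N' ->
  rescaled 1 x (Conj N N' x).
Proof.
move=> N0 N'0 NN'; have radE : rad N = rad N' by rewrite /rad NN'.
have sub (a b : nat) : (0 < b)%N -> primes b = primes a -> \pi(a).-nat b.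
  by move=> b0 ba; apply: pnat_primes => // p; rewrite ba.
have r1 := Conj_rad_rescaled x N0 erefl.
apply: rescaled1_trans r1 _; first by rewrite sub // primes_rad.
rewrite -{1}[1]invr1; apply: inv_map_rescaled => //.
- exact: rad_gt0.
- by rewrite sub ?rad_gt0 ?primes_rad.
- by rewrite sub ?primes_rad.
- exact: (smooth_ratio_nat (a := 1%N)).
- by move=> z; apply: Conj_rad_rescaled.
Qed.

Lemma Fact_rescaled N N' x : (0 < N)%N -> (0 < N')%N ->
  {subset primes N' <= primes N} -> rescaled 1 x (Fact N N' x).
Proof.
move=> N0 N'0 sub; rewrite /Fact /=.
apply: rescaled1_trans (Conj_rad_rescaled x N0 erefl) _.
  by apply: pnat_primes => // p; rewrite primes_rad //; apply: sub.
have r1 : \pi(rad N').-nat N' by apply: pnat_primes => // p; rewrite primes_rad.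
apply: rescaled1_trans r1 (Fact_sqfree_rescaled _ _ _ _ _) _; rewrite ?rad_gt0 ?rad_rad //.
  by move=> p; rewrite !primes_rad //; apply: sub.
by apply: Conj_rescaled; rewrite ?rad_gt0 ?primes_rad.
Qed.

(** * The topology of configurations *)

Local Open Scope classical_set_scope.

Definition agree N (n : nat) (x y : conf N) : Prop :=
  forall i : int, `|i| <= n%:Z -> y i = x i.

Lemma agree_sym N n (x y : conf N) : agree n x y -> agree n y x.
Proof. by move=> xy i /xy. Qed.

Lemma agree_trans N n (x y z : conf N) : agree n x y -> agree n y z -> agree n x z.
Proof. by move=> xy yz i ni; rewrite yz // xy. Qed.

Lemma agree_le N m n (x y : conf N) : (m <= n)%N -> agree n x y -> agree m x y.
Proof. by move=> mn xy i im; apply: xy; apply: le_trans im _; rewrite lez_nat. Qed.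

Lemma agree_all N (x y : conf N) : (forall n, agree n x y) -> y = x.
Proof. by move=> xy; apply/funext => i; apply: (xy `|i|%N); rewrite abszE. Qed.

Lemma nbhs_confP N (x : conf N) (A : set (conf N)) :
  nbhs x A <-> exists n, [set y | agree n x y] `<=` A.
Proof.
split=> [|[n nA]].
  (* The filter generated by agreement on growing windows converges to [x], since convergence in the
     product can be tested coordinatewise. *)
  pose F := filter_from [set: nat] (fun n => [set y : conf N | agree n x y]).
  have FF : Filter F.
    apply: filter_from_filter; first by exists 0%N.
    move=> m n _ _; exists (maxn m n) => // y xy.
    by split; apply: agree_le xy; rewrite ?leq_maxl ?leq_maxr.
  have Fx : F --> x.
    apply/cvg_sup => i B; rewrite nbhsE => -[C [[D oD <-] Dx] DB].
    by exists `|i|%N => // y /(_ i) /= yx; apply: DB; rewrite /= yx ?abszE.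
  by move=> /Fx [n _ nA]; exists n.
(* Conversely, agreement on a window is a finite intersection of single-coordinate conditions. *)
apply: filterS nA _.
have nbhs_eq i : nbhs x [set y : conf N | y i = x i].
  have := @proj_continuous int (fun=> discrete_topology (Sigma N)) i x.
  by move=> /(_ [set x i]); apply; apply: discrete_set1.
elim: n => [|n IH].
  apply: filterS (nbhs_eq 0) => y /= y0 i.
  by rewrite normr_le0 => /eqP ->.
apply: filterS (filterI IH (filterI (nbhs_eq n.+1%:Z) (nbhs_eq (- n.+1%:Z)))).
move=> y [/= yn [y1 y2]] i; rewrite le_eqVlt => /orP[|ni].
  by rewrite eqr_norml => /andP[/orP[] /eqP -> _].
by apply: yn; move: ni; lia.
Qed.

Lemma conf_compact N : compact [set: conf N].
Proof.
have := @tychonoff int (fun=> discrete_topology (Sigma N)) (fun=> setT) _.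
rewrite (_ : [set f | _] = setT); last by apply/seteqP; split.
apply => i; apply: finite_compact.
exact: (@finite_finset 'I_N.-1.+1).
Qed.

Lemma conf_hausdorff N : hausdorff_space (conf N).
Proof.
by apply: (@hausdorff_product int (fun=> discrete_topology (Sigma N))) => i;
  apply: discrete_hausdorff.
Qed.

Lemma conf_continuousP N N' (f : conf N -> conf N') :
  (forall i : int, exists n, forall x y, agree n x y -> f y i = f x i) ->
  continuous f.
Proof.
move=> f_loc x A /nbhs_confP[n nA].
suff [m mf] : exists m, forall x y, agree m x y -> agree n (f x) (f y).
  by apply/nbhs_confP; exists m => y /mf /nA.
elim: n {A nA} => [|n [m IH]].
  have [m mf] := f_loc 0; exists m => u v /mf uv i.
  by rewrite normr_le0 => /eqP ->.
have [m1 m1f] := f_loc n.+1%:Z; have [m2 m2f] := f_loc (- n.+1%:Z).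
exists (maxn m (maxn m1 m2)) => u v uv i; rewrite le_eqVlt => /orP[|ni].
  rewrite eqr_norml => /andP[/orP[] /eqP -> _].
    by apply: m1f; apply: agree_le uv; rewrite !leq_max leqnn orbT.
  by apply: m2f; apply: agree_le uv; rewrite !leq_max leqnn !orbT.
apply: (IH u v); first by apply: agree_le uv; rewrite leq_maxl.
by move: ni; lia.
Qed.

(** * An ultrametric inducing the prodiscrete topology *)

Section Metric.
Variables (R : realType) (N : nat).
Implicit Types x y z : conf N.

Let apart x y : pred nat := fun n => `[< ~ agree n x y >].

Definition conf_dist x y : R :=
  if pselect (exists n, apart x y n) is left xy then (ex_minn xy).+1%:R^-1 else 0.

(** [apart] is upward closed in the radius, so its least element decides agreement at every radius.
    The metric axioms are all read off from this description of balls. *)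
Lemma conf_dist_lt x y n : conf_dist x y < n.+1%:R^-1 <-> agree n x y.
Proof.
rewrite /conf_dist; case: pselect => [xy|xy]; last first.
  rewrite invr_gt0 ltr0n; split => // _; apply: contrapT => nxy.
  by apply: xy; exists n; apply/asboolP.
case: ex_minnP => m /asboolP mxy m_min.
rewrite ltf_pV2 ?posrE ?ltr0n // ltr_nat ltnS; split => [nm|nxy].
  by apply: contrapT => /asboolP /m_min; rewrite leqNgt nm.
by rewrite ltnNge; apply/negP => mn; apply: mxy; apply: agree_le nxy.
Qed.

Lemma conf_dist_val x y :
  conf_dist x y = 0 \/ exists n, conf_dist x y = n.+1%:R^-1.
Proof.
by rewrite /conf_dist; case: pselect => [xy|]; [right; eexists|left].
Qed.

Lemma conf_dist_ge0 x y : 0 <= conf_dist x y.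
Proof. by have [->|[n ->]] := conf_dist_val x y; rewrite ?invr_ge0. Qed.

Lemma conf_dist_sym x y : conf_dist x y = conf_dist y x.
Proof.
suff le u v : conf_dist u v <= conf_dist v u by apply: le_anti; rewrite !le.
have [->|[n uv]] := conf_dist_val u v; first exact: conf_dist_ge0.
rewrite uv leNgt; apply/negP => /conf_dist_lt /agree_sym /conf_dist_lt.
by rewrite uv ltxx.
Qed.

Lemma conf_dist_triangle x y z :
  conf_dist x z <= conf_dist x y + conf_dist y z.
Proof.
have [->|[n xz]] := conf_dist_val x z; first by rewrite addr_ge0 ?conf_dist_ge0.
rewrite leNgt; apply/negP => H.
have xy : agree n x y.
  by apply/conf_dist_lt; rewrite -xz; apply: le_lt_trans H; rewrite lerDl conf_dist_ge0.
have yz : agree n y z.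
  by apply/conf_dist_lt; rewrite -xz; apply: le_lt_trans H; rewrite lerDr conf_dist_ge0.
by have /conf_dist_lt := agree_trans xy yz; rewrite xz ltxx.
Qed.

Lemma conf_metrizable : metrizable R (conf N).
Proof.
exists conf_dist; split => [x y|x y|x y z|x A].
- split => [xy|<-].
    by apply/esym/agree_all => n; apply/conf_dist_lt; rewrite xy invr_gt0 ltr0n.
  have [//|[n xx]] := conf_dist_val x x.
  have /conf_dist_lt : agree n x x by [].
  by rewrite xx ltxx.
- exact: conf_dist_sym.
- exact: conf_dist_triangle.
split => [/nbhs_confP[n nA]|[e e0 eA]].
  exists n.+1%:R^-1; first by rewrite invr_gt0 ltr0n.
  by move=> y /conf_dist_lt; apply: nA.
apply/nbhs_confP; exists (Num.truncn e^-1) => y xy; apply: eA => /=.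
have /conf_dist_lt /lt_trans := xy; apply.
by rewrite invf_plt ?posrE // truncnS_gt.
Qed.

End Metric.

(** * Continuity and surjectivity of rescalings *)

Section RescaledDynamics.
Variables (N N' : nat).
Hypotheses (N_gt0 : (0 < N)%N) (N'_gt0 : (0 < N')%N) (N'N : \pi(N).-nat N').

Lemma rescaled_continuous al (f : conf N -> conf N') : smooth_ratio N al ->
  (forall x, rescaled al x (f x)) -> continuous f.
Proof.
move=> alN fP; apply: conf_continuousP => i.
have rN : smooth_ratio N (N'%:R ^ i * al).
  by apply: smooth_ratioM alN; apply/(smooth_ratio_trans N'N)/smooth_ratio_base.
have [j [k [t [P tN]]]] := reading_exists N_gt0 rN N'N.
(* The [k] digits ending at [j], which determine digit [i] of the image, lie within this radius. *)
exists (`|j| + k)%N => x y xy; apply: val_inj.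
rewrite -[LHS]/(digit (f y) i) -[RHS]/(digit (f x) i).
rewrite -!residue_digit // !fP ?pnat_pi //; try exact: smooth_ratio_base.
rewrite !(residueE N_gt0 _ rN P); congr ((_ %/ _) %% _)%N.
apply: eq_bigr => l _; rewrite /digit xy //; have := ltn_ord l; lia.
Qed.

End RescaledDynamics.

(** For an actual rational number the division law is floor (floor (z t) / t) = floor z. *)
Lemma truncn_system N X : (0 < N)%N -> 0 <= X ->
  residue_system N (fun r s => Num.truncn (X * r) %% s)%N.
Proof.
move=> N0 X0; split=> [r s _ /pnat_gt0 s0|r s s' _ _ s's|r s t rN /pnat_gt0 s0 /pnat_gt0 t0].
- by rewrite ltn_mod.
- by rewrite modn_dvdm.
have Xr : 0 <= X * r by rewrite mulr_ge0 // ltW // (smooth_ratio_gt0 rN).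
rewrite -modn_divl; congr (_ %% _)%N; rewrite mulrA.
set z := X * r in Xr *.
have zt : 0 <= z * t%:R by rewrite mulr_ge0.
apply/esym/eqP; rewrite truncn_eq //; apply/andP; split.
  rewrite -(ler_pM2r (_ : 0 < t%:R)) ?ltr0n // -natrM -truncn_ge_nat //.
  exact: leq_trunc_div.
rewrite -(ltr_pM2r (_ : 0 < t%:R)) ?ltr0n // -natrM -truncn_lt_nat //.
by rewrite ltn_ceil.
Qed.

Section Surjective.
Variables (N N' : nat).
Hypotheses (N_gt0 : (0 < N)%N) (N'_gt0 : (0 < N')%N) (N'N : \pi(N).-nat N').

Lemma word_modn (y : conf N') j k : (word y j k.+1 %% N')%N = digit y j.
Proof.
by rewrite -addn1 word_cat word1 expn1 modnMDl modn_small ?digit_lt.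
Qed.

(* The witness is the base-N expansion of the rational number whose base-N'
   digits are those of y at the positions -n, ..., n. *)
Lemma rescaled_dense (f : conf N -> conf N') (y : conf N') n :
  (forall x, rescaled 1 x (f x)) -> exists x, agree n y (f x).
Proof.
move=> fP; pose X : rat := (word y n%:Z (2 * n).+1)%:R / N'%:R ^ n%:Z.
have X0 : 0 <= X by rewrite divr_ge0 // exprz_ge0.
pose x := mkconf N (fun i => Num.truncn (X * N%:R ^ i) %% N)%N.
have xX := residue_system_unique N_gt0 (truncn_system N_gt0 X0) (y := x).
exists x => i ni; apply: val_inj.
rewrite -[LHS]/(digit (f x) i) -[RHS]/(digit y i).
have iN' := smooth_ratio_base i N'_gt0.
rewrite -residue_digit // fP ?pnat_pi // mulr1 xX //; first last.
- exact: smooth_ratio_trans iN'.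
- by move=> l; rewrite digit_mkconf // ltn_mod.
have [e [e2n ei]] : exists e, (e <= 2 * n)%N /\ n%:Z = i + e%:Z.
  by exists `|n%:Z - i|%N; lia.
(* Scaling by [N' ^ i] leaves the last [e] digits of the word behind the radix point, and the
   integer part drops them. *)
have -> : Num.truncn (X * N'%:R ^ i) = word y i (2 * n - e).+1.
  have -> : X * N'%:R ^ i = (word y n (2 * n).+1)%:R / (N' ^ e)%:R.
    have En : N'%:R ^ n%:Z = N'%:R ^ i * (N' ^ e)%:R :> rat.
      by rewrite ei expfzDr ?natr_base_neq0 // natrX exprnP.
    by rewrite /X En invfM mulrA mulrAC divfK // expfz_neq0 ?natr_base_neq0.
  have Ne0 : 0 < (N' ^ e)%:R :> rat by rewrite ltr0n expn_gt0 N'_gt0.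
  have -> : (2 * n).+1 = ((2 * n - e).+1 + e)%N by lia.
  rewrite ei; set w := word y (i + e%:Z) _.
  have -> : word y i (2 * n - e).+1 = (w %/ N' ^ e)%N by rewrite word_div.
  apply/eqP; rewrite truncn_eq ?divr_ge0 // ler_pdivlMr // ltr_pdivrMr //.
  rewrite -!natrM ler_nat ltr_nat leq_trunc_div ltn_ceil ?expn_gt0 ?N'_gt0 //.
by rewrite word_modn.
Qed.

Lemma rescaled_surjective (f : conf N -> conf N') :
  (forall x, rescaled 1 x (f x)) -> forall y, exists x, f x = y.
Proof.
move=> fP y; have f_cont : continuous f.
  by apply: rescaled_continuous fP => //; apply: (smooth_ratio_nat (a := 1%N)).
have /(compact_closed (@conf_hausdorff N')) cl : compact (f @` [set: conf N]).
  apply: continuous_compact; last exact: conf_compact.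
  exact: continuous_subspaceT.
suff [x _ <-] : (f @` [set: conf N]) y by exists x.
apply: cl => B /nbhs_confP[n nB].
by have [x xy] := rescaled_dense y n fP; exists (f x); split; [exists x | apply: nB].
Qed.

End Surjective.

(** * The represented real number *)

Section RealVal.
Variables (R : realType) (N : nat).
Hypothesis N_gt0 : (0 < N)%N.
Implicit Types (x : conf N) (j : int) (k : nat).

Let N_neq0 : N%:R != 0 :> R. Proof. by rewrite pnatr_eq0 -lt0n. Qed.
Let NX_gt0 j : 0 < N%:R ^ j :> R. Proof. by rewrite exprz_gt0 // ltr0n. Qed.

(** A partial sum of the series [real_val]: the digit at position [j] has weight [N ^ (- j)]. *)
Definition word_val x j k : R := (word x j k)%:R / N%:R ^ j.

Let window j k : seq int := [seq i%:Z - j | i <- iota 0 k].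

Let window_uniq j k : uniq (window j k).
Proof.
rewrite map_inj_in_uniq ?iota_uniq // => a b _ _ ab.
by have /(addIr _) [] := ab.
Qed.

Lemma word_valE x j k :
  word_val x j k = \sum_(i <- window j k) (digit x (- i))%:R * N%:R ^ i.
Proof.
rewrite /word_val /word natr_sum mulr_suml big_map.
have -> : iota 0 k = index_iota 0 k by rewrite /index_iota subn0.
rewrite big_mkord; apply: eq_bigr => i _.
by rewrite opprB expfzDr // natrM natrX mulrA -invr_expz.
Qed.

Lemma word_val_le x j k : ((word_val x j k)%:E <= real_val R x)%E.
Proof.
apply: esum_ge; exists [set` window j k]; first by split=> //; apply: finite_seq.
by rewrite -fsbig_seq ?window_uniq // sumEFin word_valE lexx.
Qed.

(** Every finite set of exponents lies in some interval from [-n] to [n], that is, in the window of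
    the [2n + 1] digits ending at [n]. *)
Lemma real_val_le x (B : \bar R) :
  (forall j k, ((word_val x j k)%:E <= B)%E) -> (real_val R x <= B)%E.
Proof.
move=> wB; apply: ge_ereal_sup => _ [A [finA _] <-].
have /finite_seqP[s As] := finA.
pose n := (\max_(a <- s) `|a|)%N.
apply: le_trans (wB n%:Z (2 * n).+1); rewrite word_valE -sumEFin.
rewrite [X in (_ <= X)%E]fsbig_seq ?window_uniq //.
apply: lee_fsum_nneg_subset => //=.
  rewrite As => a; rewrite !inE /= => sa; apply/mapP.
  have an : (`|a| <= n)%N by rewrite /n (big_rem a) //= leq_maxl.
  by exists (absz (a + n%:Z)); rewrite ?mem_iota; lia.
by move=> a _; rewrite lee_fin mulr_ge0 // ltW.
Qed.

Lemma real_val_ge0 x : (0 <= real_val R x)%E.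
Proof. by apply: esum_ge0 => i _; rewrite lee_fin mulr_ge0 // ltW. Qed.

Lemma word_val_mono x j k e e' :
  word_val x j k <= word_val x (j + e%:Z) (k + e + e').
Proof.
rewrite /word_val expfzDr // invfM mulrA mulrAC ler_pM2r ?invr_gt0 //.
rewrite ler_pdivlMr // -exprnP -natrX -natrM ler_nat.
rewrite -(word_div N_gt0 x j k e); apply: leq_trans (leq_trunc_div _ _) _.
by rewrite [(k + e + e')%N]addnC [X in (_ <= X)%N]word_cat leq_addl.
Qed.

(** Unlike [read_lengthen], this extends the window towards less significant digits, which forces a
    larger divisor. *)
Lemma reading_lengthen r s j k t e : reading N r s (j, k, t) ->
  reading N r s (j + e%:Z, (k + e)%N, (t * N ^ e)%N).
Proof.
move=> [/= t0 tr st]; split => /=.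
- by rewrite muln_gt0 t0 expn_gt0 N_gt0.
- by rewrite natrM mulrAC tr expfzDr ?natr_base_neq0 // natrX.
- by rewrite mulnA expnD dvdn_mul.
Qed.

(** Reducing modulo [s] and rounding down only lower the value, and the digits read form a partial
    sum. *)
Lemma residue_le_val x r s : smooth_ratio N r -> \pi(N).-nat s ->
  ((residue x r s)%:R%:E <= real_val R x * (ratr r)%:E)%E.
Proof.
move=> rN sN; have [j [k [t [P tN]]]] := reading_exists N_gt0 rN sN.
rewrite (residueE N_gt0 x rN P); case: P => /= t0 tr _.
have r0 : 0 < ratr r :> R by rewrite ltr0q (smooth_ratio_gt0 rN).
have trR : t%:R * ratr r = N%:R ^ j :> R.
  by have := congr1 (@ratr R) tr; rewrite rmorphM /= ratr_nat fmorphXz /= ratr_nat.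
have t0R : 0 < t%:R :> R by rewrite ltr0n.
apply: le_trans (lee_wpmul2r _ (word_val_le x j k)); last by rewrite lee_fin ltW.
rewrite -EFinM lee_fin /word_val -trR invfM (mulrA _ t%:R^-1) divfK ?lt0r_neq0 //.
rewrite ler_pdivlMr // -natrM ler_nat.
exact: leq_trans (leq_mul (leq_mod _ _) (leqnn _)) (leq_trunc_div _ _).
Qed.

(* Once s exceeds the value of x times r, the residue is an integer part. *)
Lemma word_val_lt x r s j k : smooth_ratio N r -> \pi(N).-nat s ->
  (real_val R x * (ratr r)%:E < s%:R%:E)%E ->
  word_val x j k * ratr r < (residue x r s).+1%:R.
Proof.
move=> rN sN xs; have [j0 [k0 [t0 [P0 _]]]] := reading_exists N_gt0 rN sN.
have r0 : 0 < ratr r :> R by rewrite ltr0q (smooth_ratio_gt0 rN).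
(* The reading is extended to the right until its end [j1] is at least [j], then to the left, so
   that it covers the [k] digits ending at [j]. *)
pose e0 := absz (j - j0); pose j1 := j0 + e0%:Z.
have [e j1e] : exists e : nat, j1 = j + e%:Z.
  by exists (absz (j1 - j)); rewrite /j1 /e0; lia.
have P1 := reading_lengthen e0 P0; rewrite -/j1 in P1.
pose e1 := (k + e)%N.
have [P _] := read_lengthen x e1 P1.
rewrite (residueE N_gt0 x rN P).
set k1 := (k0 + e0 + e1)%N; set t := (t0 * N ^ e0)%N in P *.
case: P => /= t_gt0 tr _.
have trR : t%:R * ratr r = N%:R ^ j1 :> R.
  by have := congr1 (@ratr R) tr; rewrite rmorphM /= ratr_nat fmorphXz /= ratr_nat.
have t0R : 0 < t%:R :> R by rewrite ltr0n.
have wE : word_val x j1 k1 * ratr r = (word x j1 k1)%:R / t%:R.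
  by rewrite /word_val -trR invfM (mulrA _ t%:R^-1) divfK ?lt0r_neq0.
have small : (word x j1 k1 %/ t < s)%N.
  rewrite ltn_divLR // -(ltr_nat R) natrM -ltr_pdivrMr // -wE -lte_fin.
  apply: le_lt_trans xs; rewrite EFinM; apply: lee_wpmul2r.
    by rewrite lee_fin ltW.
  exact: word_val_le.
rewrite modn_small //.
apply: (@le_lt_trans _ _ (word_val x j1 k1 * ratr r)).
  rewrite ler_pM2r // j1e /k1 /e1 (_ : (k0 + e0 + (k + e))%N = (k + e + (k0 + e0))%N) //.
    exact: word_val_mono.
  by rewrite addnC.
by rewrite wE ltr_pdivrMr // -natrM ltr_nat ltn_ceil.
Qed.

End RealVal.

Lemma rescaled_real_val (R : realType) N N' (x : conf N) (y : conf N') :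
  (0 < N)%N -> (1 < N')%N -> \pi(N).-nat N' -> rescaled 1 x y ->
  (real_val R x < +oo)%E -> real_val R y = real_val R x.
Proof.
move=> N0 N'1 N'N xy xfin; have N'0 := ltnW N'1.
have xR : real_val R x \is a fin_num by rewrite ge0_fin_numE ?real_val_ge0.
have N'r j : smooth_ratio N (N'%:R ^ j) by apply/(smooth_ratio_trans N'N)/smooth_ratio_base.
have N'X_gt0 j : 0 < N'%:R ^ j :> R by rewrite exprz_gt0 // ltr0n.
have ratrN' j : ratr (N'%:R ^ j) = N'%:R ^ j :> R by rewrite fmorphXz /= ratr_nat.
have resE j k : word y j k = residue x (N'%:R ^ j) (N' ^ k).
  rewrite -residue_base // xy ?mulr1 //; first exact: smooth_ratio_base.
  by rewrite pnatX pnat_pi.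
set v := fine (real_val R x).
have vE : real_val R x = v%:E by rewrite fineK.
have yx : (real_val R y <= real_val R x)%E.
  apply: real_val_le => // j k; rewrite /word_val resE vE lee_fin ler_pdivrMr //.
  have := residue_le_val R N0 x (N'r j) (_ : \pi(N).-nat (N' ^ k)%N).
  by rewrite vE ratrN' -EFinM lee_fin pnatX N'N; apply.
apply: le_anti; rewrite yx /=.
have yR : real_val R y \is a fin_num.
  by rewrite ge0_fin_numE ?real_val_ge0 //; apply: le_lt_trans xfin.
set w := fine (real_val R y).
have wE : real_val R y = w%:E by rewrite fineK.
apply: real_val_le => // j k; rewrite wE lee_fin.
apply/ler_addgt0Pr => e e0.
(* Passing to the integer part after scaling by [N' ^ i] loses less than 1, hence less than [e]
   after scaling back. *)
pose i := Num.truncn e^-1.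
have N'i : e^-1 < N'%:R ^ i%:Z.
  apply: lt_le_trans (truncnS_gt _) _; rewrite -exprnP -natrX ler_nat.
  exact: ltn_expl.
(* With this [l], [N' ^ l] exceeds [v * N' ^ i], so [word_val_lt] applies with modulus [N' ^ l];
   here [1 < N'] matters. *)
pose l := Num.truncn (v * N'%:R ^ i%:Z).
have := @word_val_lt R N N0 x (N'%:R ^ i%:Z) (N' ^ l)%N j k (N'r _).
rewrite pnatX N'N vE ratrN' -EFinM lte_fin => /(_ isT) H.
have {H} := H _.
rewrite -resE => H.
have : word_val R x j k * N'%:R ^ i%:Z < (word y i l).+1%:R.
  apply: H; apply: lt_le_trans (truncnS_gt _) _; rewrite ler_nat; exact: ltn_expl.
rewrite -ltr_pdivlMr // -natr1 mulrDl mul1r => /ltW/le_trans; apply.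
apply: lerD; first by rewrite -lee_fin -wE; apply: word_val_le.
by rewrite -[e]invrK lef_pV2 ?posrE ?invr_gt0 // ltW.
Qed.

Unset Implicit Arguments.

Theorem corollary5p13 (R : realType) (N1 N2 : nat)
    (hN1 : (1 < N1)%N) (hN2 : (1 < N2)%N)
    (hprimes : forall p : nat, prime p -> (p %| N2)%N -> (p %| N1)%N) :
  (forall alpha : rat, 0 < alpha ->
     Pi_defined N1 alpha -> Pi_defined N2 alpha ->
     has_factor_via R (Pi N1 alpha) (Pi N2 alpha) (Fact N1 N2)) /\
  (forall x : conf N1, (real_val R x < +oo)%E ->
     real_val R (Fact N1 N2 x) = real_val R x).
Proof.
have [N1_gt0 N2_gt0] := (ltnW hN1, ltnW hN2).
have sub : {subset primes N2 <= primes N1}.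
  by move=> p; rewrite !mem_primes N1_gt0 => /and3P[pp _ /(hprimes p pp) ->]; rewrite pp.
have N21 := pnat_primes N2_gt0 sub.
have FactP x : rescaled 1 x (Fact N1 N2 x) by apply: Fact_rescaled.
split=> [alpha _ d1 d2|x]; last exact: rescaled_real_val (FactP x).
have dyn N : (0 < N)%N -> Pi_defined N alpha -> dynamical_system R (Pi N alpha).
  move=> N_gt0 dN; split; [exact: conf_compact | exact: conf_metrizable |].
  have NN : \pi(N).-nat N by rewrite pnat_pi.
  apply: (rescaled_continuous N_gt0 N_gt0 NN (Pi_defined_smooth N_gt0 dN)) => x.
  exact: Pi_rescaled.
split; [exact: dyn | exact: dyn | | exact: rescaled_surjective | move=> x].
  by apply: rescaled_continuous FactP => //; apply: (smooth_ratio_nat (a := 1%N)).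
have [s1 s2] := (Pi_defined_smooth N1_gt0 d1, Pi_defined_smooth N2_gt0 d2).
(* Both composites rescale [x] by [alpha], and the rescaling is unique. *)
transitivity (rescale N2 alpha x).
  apply: rescaled_eq => //; rewrite -[alpha]mul1r.
  apply: rescaled_comp (FactP _) => //; first exact: (smooth_ratio_nat (a := 1%N)).
  by rewrite mul1r; apply: Pi_rescaled.
apply/esym/rescaled_eq => //; rewrite -[alpha]mulr1.
apply: rescaled_comp (FactP x) _ => //; first by rewrite pnat_pi.
by rewrite mulr1; apply: Pi_rescaled.
Qed.
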